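(* Let $1 \le \alpha < \omega_1$ be an ordinal. Then there is a closed set $F \subset 2^{\omega} \times \omega^{\omega}$ such that for every $x \in 2^{\omega}$ the section $F_x$ is a countable discrete set, and $F$ cannot be covered by countably many sets $B(n) \subset F$, $n \in \omega$, such that each $B(n)$ belongs to the Borel class $\boldsymbol{\Sigma}^0_\alpha$ and the section $B(n)_x$ is compact for every $n \in \omega$ and every $x \in 2^{\omega}$.
   Context: $2^\omega$ is the Cantor space and $\omega^\omega$ the Baire space, with product topologies. $\boldsymbol{\Sigma}^0_\alpha$ denotes the additive Borel class of rank $\alpha$ (here in $2^\omega\times\omega^\omega$). For $B \subset X\times Y$ and $x\in X$, $B_x=\{y\in Y:(x,y)\in B\}$. *)

(* Defs.v *)
From HB Require Import structures.
From mathcomp Require Import all_boot all_order all_algebra.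
From mathcomp Require Import all_classical all_reals all_analysis.
Set Implicit Arguments. Unset Strict Implicit. Unset Printing Implicit Defensive.
Local Open Scope classical_set_scope.

Definition baire_space : Type := prod_topology (fun _ : nat => nat).
HB.instance Definition _ := Pointed.on baire_space.
HB.instance Definition _ := Nbhs.on baire_space.
HB.instance Definition _ := Topological.on baire_space.

(* Countable ordinals.  A countable well-order is encoded by a strict
   well-ordering [lt] on nat.  An element [i] of it stands for the ordinal
   1 + otp({j | lt j i}); as lt ranges over countable well-orders and i over
   its elements, this ranges over exactly the ordinals 1 <= alpha < omega_1. *)
Definition strict_wellorder (lt : nat -> nat -> Prop) : Prop :=
  [/\ well_founded lt,
      (forall a b c, lt a b -> lt b c -> lt a c)
    & (forall a b, lt a b \/ a = b \/ lt b a)].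

(* Additive Borel classes: [Sigma0 lt i S] means S belongs to
   Sigma^0_{1 + otp({j | lt j i})}.
   - open sets are in every class (they form Sigma^0_1, the class at the
     least element);
   - a countable union of sets A n whose complements lie in Sigma^0 classes
     of strictly smaller indices (i.e. A n is Pi^0_beta, beta < alpha) is in
     the class of i. *)
Inductive Sigma0 {T : topologicalType} (lt : nat -> nat -> Prop) :
    nat -> set T -> Prop :=
  | Sigma0_open i (S : set T) : open S -> Sigma0 lt i S
  | Sigma0_union i (A : nat -> set T) (j : nat -> nat) :
      (forall n, lt (j n) i) ->
      (forall n, Sigma0 lt (j n) (~` A n)) ->
      Sigma0 lt i (\bigcup_n A n).

Definition section {X Y : Type} (B : set (X * Y)) (x : X) : set Y :=
  [set y | B (x, y)].

Definition discrete_set {T : topologicalType} (D : set T) : Prop :=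
  forall y, D y -> exists U : set T, [/\ open U, U y & U `&` D = [set y]].

(* Main.v *)
(* Code points by branches of trees on pairs (y, x), a section being obtained by
   fixing all the x's.  A compact subset of a closed discrete section is finite,
   so it is enough to find a tree whose branches are isolated in their sections
   and such that in every countable cover of its branches by Sigma_alpha sets some
   member contains infinitely many branches of one section.  For covers by
   relatively open sets the key tree works, because each of its nonempty
   relatively open sets contains infinitely many branches of one section.

   The general case reduces to that one by operators H on trees.  They preserve
   the isolation of branches in sections, and for every sequence of Sigma_alpha
   sets there is a section-preserving embedding of the branches of T into those of
   H T under which all the given sets become relatively open.  They are obtained
   by induction on alpha from a single jump, which turns relatively open sets into
   relatively clopen ones, and from infinite compositions in which the n-th
   operator does not change the first n levels.

   The jump is a finite-injury construction.  A branch of H T simulates a branch of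
   T while its parameter raises a level or resets it to a smaller one, which undoes
   the simulation beyond that level.  If the levels do not tend to infinity, the
   branch is isolated in its section.  The embedding decides one set for one string
   of T at each level: if some continuation forces membership in the set, it
   follows the continuation and resets, so that the simulating thread remembers
   the forcing string in its past; otherwise no later continuation forces it, and
   by openness the point stays outside the set. *)

Require Import Defs.
From HB Require Import structures.
From mathcomp Require Import all_boot all_order all_algebra.
From mathcomp Require Import all_classical all_reals all_analysis.
From mathcomp Require Import zify.
Local Open Scope classical_set_scope.

Set Implicit Arguments. Unset Strict Implicit. Unset Printing Implicit Defensive.

(** * Trees and section-preserving maps *)

(* A symbol is a pair (y, x): [y] is an entry of the point of the Baire space,
   [x] an entry of the parameter, at first taken in the Baire space as well. *)
Notation sym := (nat * nat)%type.
Notation tree := (seq sym -> Prop).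
Notation pts := (nat -> sym).

Definition pre (z : pts) (n : nat) : seq sym := mkseq z n.
Definition sect (z z' : pts) : Prop := forall n, (z n).2 = (z' n).2.
Definition br (T : tree) (z : pts) : Prop := forall n, T (pre z n).
Definition pclosed (T : tree) : Prop := forall s a, T (rcons s a) -> T s.
Definition tagree (m : nat) (T T' : tree) : Prop :=
  forall s, size s <= m -> (T s <-> T' s).
(** The limit of [psi] along the prefixes of [z], for monotone [psi] that does not shorten strings.
    Entry [n] depends on the first [n.+1] entries of [z] only, which makes the map continuous. *)
Definition ext (psi : seq sym -> seq sym) (z : pts) : pts :=
  fun n => nth (0, 0) (psi (pre z n.+1)) n.

Lemma size_pre z n : size (pre z n) = n.
Proof. exact: size_mkseq. Qed.

Lemma preS z n : pre z n.+1 = rcons (pre z n) (z n).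
Proof. exact: mkseqS. Qed.

Lemma take_pre z m n : m <= n -> take m (pre z n) = pre z m.
Proof. by move=> mn; rewrite /pre /mkseq -map_take take_iota (minn_idPl mn). Qed.

Lemma nth_pre x0 z m n : m < n -> nth x0 (pre z n) m = z m.
Proof. exact: nth_mkseq. Qed.

Lemma pre_le z z' m n : m <= n -> pre z n = pre z' n -> pre z m = pre z' m.
Proof. by move=> mn e; rewrite -(take_pre z mn) -(take_pre z' mn) e. Qed.

Lemma preP z z' n : pre z n = pre z' n <-> (forall m, m < n -> z m = z' m).
Proof.
split=> [e m mn|e]; first by rewrite -(nth_pre (0, 0) z mn) e nth_pre.
by apply/eq_in_map => m; rewrite mem_iota => /andP[_ mn]; apply: e.
Qed.

Lemma pre_inj z z' : (forall n, pre z n = pre z' n) -> z = z'.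
Proof. by move=> e; apply/funext => n; have /preP := e n.+1; apply. Qed.

Lemma sect_refl z : sect z z. Proof. by []. Qed.

Lemma xs_pre z z' n : sect z z' -> map snd (pre z n) = map snd (pre z' n).
Proof. by move=> h; rewrite -!map_comp; apply: eq_map => m /=; rewrite h. Qed.

Lemma pclosed_take T s n : pclosed T -> T s -> T (take n s).
Proof.
move=> pT; elim/last_ind: s => [|s a IH] // Ts.
have [le|lt] := leqP (size (rcons s a)) n; first by rewrite take_oversize.
rewrite size_rcons ltnS in lt; rewrite -cats1 takel_cat //.
exact/IH/pT/Ts.
Qed.

Lemma pclosed_prefix T s s' : pclosed T -> prefix s s' -> T s' -> T s.
Proof. by rewrite prefixE => pT /eqP e /(pclosed_take (size s) pT); rewrite e. Qed.

Lemma prefix_pre z m n : m <= n -> prefix (pre z m) (pre z n).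
Proof. by move=> mn; rewrite prefixE size_pre take_pre. Qed.

Lemma prefix_preE s z n : prefix s (pre z n) -> s = pre z (size s).
Proof.
move=> p; have := size_prefix p; rewrite size_pre => le.
by move: p; rewrite prefixE => /eqP e; rewrite -[LHS]e take_pre.
Qed.

Lemma tagree_sym m T T' : tagree m T T' -> tagree m T' T.
Proof. by move=> h s /h []. Qed.
Lemma tagree_trans m T1 T2 T3 : tagree m T1 T2 -> tagree m T2 T3 -> tagree m T1 T3.
Proof. by move=> h1 h2 s sm; rewrite h1 // h2. Qed.
Lemma tagree_le m n T T' : m <= n -> tagree n T T' -> tagree m T T'.
Proof. by move=> mn h s sm; apply: h; apply: leq_trans mn. Qed.

Lemma tree_ext (T T' : tree) : (forall m, tagree m T T') -> T = T'.
Proof. by move=> h; apply/funext => s; apply/propext; apply: (h (size s)). Qed.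

(* Isolation of branches in their sections passes from [T'] to [T]: a branch
   outside [G] is isolated outright, and on [G] the map [Phi] is continuous and
   injective along each section. *)
Definition fibred (k : nat) (T T' : tree) : Prop :=
  exists (G : pts -> Prop) (Phi : pts -> pts),
  [/\ forall z z', br T z -> br T z' -> sect z z' -> G z -> G z',
      forall z, br T z -> ~ G z -> exists M, forall z', br T z' -> sect z z' ->
        pre z M = pre z' M -> z = z',
      forall z, br T z -> G z -> br T' (Phi z) /\ pre (Phi z) k = pre z k,
      forall z z', br T z -> br T z' -> sect z z' -> G z -> sect (Phi z) (Phi z') &
      (forall z m, br T z -> G z -> exists M, forall z', br T z' -> sect z z' ->
         pre z M = pre z' M -> pre (Phi z) m = pre (Phi z') m) /\
      (forall z z' r, br T z -> br T z' -> sect z z' -> G z ->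
         pre (Phi z) r = pre (Phi z') r -> pre z r = pre z' r)].

(* The first two clauses make the composition of operators with parameters
   k, k + 1, k + 2, etc. well defined: level [n] is settled after [n] steps. *)
Definition oper (k : nat) (H : tree -> tree) : Prop :=
  [/\ forall m T T', tagree m T T' -> tagree m (H T) (H T'),
      forall T, tagree k (H T) T,
      forall T, pclosed T -> pclosed (H T) &
      forall T, pclosed T -> fibred k (H T) T].

(** The size bound keeps [ext psi] from reading default entries, the prefix of length [k] lets
    infinitely many such maps be composed, and the last clause makes [ext psi] carry sections into
    sections. *)
Definition preembeds (k : nat) (T' T : tree) (psi : seq sym -> seq sym) : Prop :=
  [/\ forall s, T' s -> T (psi s),
      forall s s', T' s' -> prefix s s' -> prefix (psi s) (psi s'),
      forall s, T' s -> size s <= size (psi s) /\ prefix (take k s) (psi s) &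
      forall s s', T' s -> T' s' -> map snd s = map snd s' ->
        map snd (psi s) = map snd (psi s')].

Definition embeds (k : nat) (T' T : tree) (psi : seq sym -> seq sym) : Prop :=
  preembeds k T' T psi /\ forall z z', br T' z -> br T' z' -> sect z z' ->
    ext psi z = ext psi z' -> z = z'.

Definition relopen (T : tree) (P : pts -> Prop) : Prop :=
  forall z, br T z -> P z -> exists n, forall z', br T z' ->
    pre z n = pre z' n -> P z'.

Definition locconst (T : tree) (P : pts -> Prop) : Prop :=
  forall z, br T z -> exists n, forall z', br T z' ->
    pre z n = pre z' n -> (P z <-> P z').

Lemma oper_id k : oper k id.
Proof.
split=> // T pT; exists (fun _ => True), id; split=> //.
by split=> // z m _ _; exists m.
Qed.

Lemma ex_least (P : nat -> Prop) : (exists n, P n) ->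
  exists n, P n /\ forall m, P m -> n <= m.
Proof.
move=> [n Pn]; have ex : exists m, `[< P m >] by exists n; apply/asboolP.
exists (ex_minn ex); case: ex_minnP => m /asboolP Pm hm; split=> // j Pj.
exact/hm/asboolP.
Qed.

(** * Maps on branches induced by maps on strings *)

Section Embeds.
Variables (k : nat) (T' T : tree) (psi : seq sym -> seq sym).
Hypotheses (pT : pclosed T) (emb : preembeds k T' T psi).

Lemma ext_pre z n m : br T' z -> m <= size (psi (pre z n)) ->
  pre (ext psi z) m = take m (psi (pre z n)).
Proof.
case: emb => h1 h2 h3 h4 bz le.
apply: (@eq_from_nth _ (0, 0)); first by rewrite size_pre size_takel.
move=> i; rewrite size_pre => im; rewrite nth_pre // nth_take // /ext.
have [le1|le1] := leqP n i.+1.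
  have /prefixP[t ->] : prefix (psi (pre z n)) (psi (pre z i.+1)).
    by apply: h2; rewrite ?prefix_pre.
  by rewrite nth_cat; case: ltnP => //; lia.
have /prefixP[t ->] : prefix (psi (pre z i.+1)) (psi (pre z n)).
  by apply: h2; rewrite ?prefix_pre // ltnW.
by rewrite nth_cat; case: ltnP => //; have [] := h3 _ (bz i.+1); rewrite size_pre; lia.
Qed.

Lemma ext_pre_size z n : br T' z ->
  pre (ext psi z) (size (psi (pre z n))) = psi (pre z n).
Proof. by move=> bz; rewrite (ext_pre bz (leqnn _)) take_size. Qed.

Lemma ext_take z n : br T' z -> pre (ext psi z) n = take n (psi (pre z n)).
Proof.
move=> bz; apply: ext_pre => //.
by case: emb => _ _ h3 _; case: (h3 _ (bz n)); rewrite size_pre.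
Qed.

Lemma ext_br z : br T' z -> br T (ext psi z).
Proof.
move=> bz n; rewrite ext_take //; apply: pclosed_take => //.
by case: emb => h1 _ _ _; apply: h1.
Qed.

Lemma ext_sect z z' : br T' z -> br T' z' -> sect z z' ->
  sect (ext psi z) (ext psi z').
Proof.
move=> bz bz' s n; have bi := ext_take n.+1 bz; have bi' := ext_take n.+1 bz'.
have /(congr1 (take n.+1)) : map snd (psi (pre z n.+1)) = map snd (psi (pre z' n.+1)).
  by case: emb => _ _ _ h4; apply: h4 => //; apply: xs_pre.
rewrite -!map_take -bi -bi' !preS !map_rcons.
by move/(congr1 (last 0)); rewrite !last_rcons.
Qed.

Lemma ext_k z : br T' z -> pre (ext psi z) k = pre z k.
Proof.
move=> bz; case: emb => _ _ h3 _; have [_] := h3 _ (bz k).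
rewrite ext_take // take_oversize ?size_pre // prefixE size_pre.
by move/eqP.
Qed.

(** Within a section the two strings have the same parameter entries, hence the same length, and
    both are prefixes of the common image. *)
Lemma ext_psi_eq z z' n : br T' z -> br T' z' -> sect z z' ->
  ext psi z = ext psi z' -> psi (pre z n) = psi (pre z' n).
Proof.
move=> bz bz' s e; case: emb => _ _ h3 h4.
have sz : size (psi (pre z n)) = size (psi (pre z' n)).
  by rewrite -[LHS](size_map snd) -[RHS](size_map snd) (h4 _ (pre z' n)) //; apply: xs_pre.
by rewrite -(ext_pre_size n bz) -(ext_pre_size n bz') sz e.
Qed.

Lemma ext_pre_eq z z' n : pre z n = pre z' n -> pre (ext psi z) n = pre (ext psi z') n.
Proof. by move=> e; apply/preP => m mn; rewrite /ext (pre_le mn e). Qed.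

End Embeds.

(** * Infinite composition of operators *)

Section InfiniteComposition.
Variables (k : nat) (H : nat -> tree -> tree).
Hypothesis opH : forall n, oper (k + n) (H n).

Fixpoint comp (n c : nat) (T : tree) : tree :=
  if c is c'.+1 then H n (comp n.+1 c' T) else T.
(** The infinite composition of [H n], [H n.+1], etc.: the operators from [H (n + size s)] on change
    nothing at the length of [s]. *)
Definition icomp (n : nat) (T : tree) : tree := fun s => comp n (size s) T s.

Lemma comp_agree n c d T : tagree (k + n + c) (comp n (c + d) T) (comp n c T).
Proof.
elim: c n => [|c IH] n; last first.
  have [h _ _ _] := opH n; rewrite addSn /=; apply: h.
  by rewrite addnS -addSn -addnS; apply: IH.
rewrite add0n addn0; elim: d n => [|d IH] n //=.
have [_ h _ _] := opH n; apply: tagree_trans (h _) _.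
by apply: tagree_le (IH n.+1); lia.
Qed.

Lemma icomp_agree n c T m : m <= k + n + c -> tagree m (icomp n T) (comp n c T).
Proof.
move=> mc s sm; rewrite /icomp; have [le|/ltnW le] := leqP (size s) c.
  by rewrite -(subnKC le); apply: iff_sym; apply: comp_agree; lia.
by rewrite -(subnKC le); apply: comp_agree; lia.
Qed.

Lemma icomp_k n T : tagree (k + n) (icomp n T) T.
Proof. by apply: (@icomp_agree n 0 T); rewrite addn0. Qed.

Lemma icompS n T : icomp n T = H n (icomp n.+1 T).
Proof.
apply: tree_ext => m; apply: tagree_trans (@icomp_agree n m.+1 T m _) _; first lia.
have [h _ _ _] := opH n; apply: h; apply: tagree_sym.
by apply: icomp_agree; lia.
Qed.

Lemma comp_mono m n c T T' : tagree m T T' -> tagree m (comp n c T) (comp n c T').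
Proof. by move=> h; elim: c n => //= c IH n; have [h1 _ _ _] := opH n; apply: h1. Qed.

Lemma icomp_mono m n T T' : tagree m T T' -> tagree m (icomp n T) (icomp n T').
Proof. by move=> h s sm; apply: (comp_mono n (size s) h). Qed.

Lemma icomp_pclosed n T : pclosed T -> pclosed (icomp n T).
Proof.
move=> pT.
have hc c m : pclosed (comp m c T) by elim: c m => //= c IH m; have [_ _ h _] := opH m; apply: h.
move=> s a; rewrite /icomp size_rcons => /hc h.
by apply/(@icomp_agree n (size s).+1 T (size s)) => //; lia.
Qed.

(** A branch is pushed through the maps [Phi n] as long as it stays in the sets [G n]. If it leaves
    at some step, it is isolated there, and isolation pulls back through finitely many continuous
    injective maps. If it never leaves, the images converge, since [Phi n] fixes the first [k + n]
    entries. *)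
Lemma icomp_fibred T : pclosed T -> fibred k (icomp 0 T) T.
Proof.
move=> pT.
have step n : fibred (k + n) (icomp n T) (icomp n.+1 T).
  by rewrite (icompS n); have [_ _ _ h] := opH n; apply: h; apply: icomp_pclosed.
have [G /choice[Phi hGP]] := choice step.
pose Z := fun z => fix Z n := if n is m.+1 then Phi m (Z m) else z.
pose good n z := forall m, m < n -> G m (Z z m).
have goodS n z : good n.+1 z -> good n z by move=> h m mn; apply: h; lia.
have brZ z n : br (icomp 0 T) z -> good n z -> br (icomp n T) (Z z n).
  move=> bz; elim: n => [|n IH] // gn.
  by have [_ _ h _ _] := hGP n; have [] := h _ (IH (goodS _ _ gn)) (gn n (ltnSn n)).
have preZ z n : br (icomp 0 T) z -> good n.+1 z ->
    pre (Z z n.+1) (k + n) = pre (Z z n) (k + n).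
  move=> bz gn; have [_ _ h _ _] := hGP n.
  by have [] := h _ (brZ _ _ bz (goodS _ _ gn)) (gn n (ltnSn n)).
have preZd z n d : br (icomp 0 T) z -> good (n + d) z ->
    pre (Z z (n + d)) (k + n) = pre (Z z n) (k + n).
  move=> bz; elim: d => [|d IH]; rewrite ?addn0 // addnS => g.
  by rewrite -(IH (goodS _ _ g)); apply: pre_le (preZ _ _ bz g); lia.
have sectZ z z' n : br (icomp 0 T) z -> br (icomp 0 T) z' -> sect z z' ->
    good n z -> good n z' /\ sect (Z z n) (Z z' n).
  move=> bz bz' s; elim: n => [|n IH] gn; first by split.
  have [g' s'] := IH (goodS _ _ gn); have [h1 _ _ h4 _] := hGP n.
  have Gn := gn n (ltnSn n); split.
    move=> m; rewrite ltnS leq_eqVlt => /orP[/eqP->|]; last exact: g'.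
    by apply: h1 s' Gn; apply: brZ => //; apply: goodS.
  by apply: h4 => //; apply: brZ => //; apply: goodS.
have contZ z n m : br (icomp 0 T) z -> good n z -> exists M, forall z',
    br (icomp 0 T) z' -> sect z z' -> pre z M = pre z' M ->
    pre (Z z n) m = pre (Z z' n) m.
  move=> bz; elim: n m => [|n IH] m gn; first by exists m.
  have [_ _ _ _ [h5 _]] := hGP n; have gn' := goodS _ _ gn.
  have [M hM] := h5 _ m (brZ _ _ bz gn') (gn n (ltnSn n)).
  have [M' hM'] := IH M gn'; exists M' => z' bz' s e.
  have [g' s'] := sectZ _ _ _ bz bz' s gn'.
  by apply: hM => //; [apply: brZ | apply: hM'].
have injZ z z' n r : br (icomp 0 T) z -> br (icomp 0 T) z' -> sect z z' ->
    good n z -> pre (Z z n) r = pre (Z z' n) r -> pre z r = pre z' r.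
  move=> bz bz' s; elim: n => [|n IH] gn // e; have gn' := goodS _ _ gn.
  have [_ _ _ _ [_ h6]] := hGP n; have [g' s'] := sectZ _ _ _ bz bz' s gn'.
  by apply: IH => //; apply: h6 e => //; [apply: brZ | apply: brZ | apply: gn].
(* Entry [m] is below [k + m.+1], so it no longer changes after step [m.+1]. *)
pose Inf z m := Z z m.+1 m.
have infE z n : br (icomp 0 T) z -> (forall n, G n (Z z n)) ->
    pre (Inf z) (k + n) = pre (Z z n) (k + n).
  move=> bz g; have g' m : good m z by move=> ? _; apply: g.
  apply/preP => m mn; rewrite /Inf; have [le|/ltnW le] := leqP m.+1 n.
    by rewrite -(subnKC le); symmetry; move: m {mn} le => m le;
       have /preP := preZd z m.+1 (n - m.+1) bz (g' _); apply; lia.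
  by rewrite -(subnKC le); have /preP := preZd z n (m.+1 - n) bz (g' _); apply; lia.
exists (fun z => forall n, G n (Z z n)), Inf.
have gd z n : (forall n, G n (Z z n)) -> good n z by move=> g ? _; apply: g.
have infT z n : br (icomp 0 T) z -> (forall n, G n (Z z n)) ->
    pre (Inf z) n = pre (Z z n) n.
  by move=> bz g; apply: pre_le (infE _ n bz g); lia.
have gS z z' : br (icomp 0 T) z -> br (icomp 0 T) z' -> sect z z' ->
    (forall n, G n (Z z n)) -> forall n, G n (Z z' n).
  move=> bz bz' s g n; have [h1 _ _ _ _] := hGP n.
  have [g' s'] := sectZ _ _ n bz bz' s (gd _ _ g).
  exact: (h1 _ _ (brZ _ _ bz (gd _ _ g)) (brZ _ _ bz' g') s' (g n)).
split=> //.
- move=> z bz /existsNP/ex_least[n [nG gn0]].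
  have gn : good n z by move=> m mn; apply: contrapT => /gn0; rewrite leqNgt mn.
  have [_ h2 _ _ _] := hGP n; have [M hM] := h2 _ (brZ _ _ bz gn) nG.
  have [M' hM'] := contZ _ _ M bz gn; exists M' => z' bz' s e.
  have [g' s'] := sectZ _ _ _ bz bz' s gn.
  have eZ : Z z n = Z z' n by apply: hM => //; [apply: brZ | apply: hM'].
  by apply: pre_inj => r; apply: (injZ _ _ n) => //; rewrite eZ.
- move=> z bz g; split; last first.
    by have := infE z 0 bz g; rewrite addn0.
  move=> n; rewrite infT //; apply/(@icomp_k n T); first by rewrite size_pre; lia.
  exact: (brZ _ _ bz (gd _ _ g)).
- move=> z z' bz bz' s g n.
  by have [g' s'] := sectZ _ _ n.+1 bz bz' s (gd _ _ g); apply: s'.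
split=> [z m bz g|z z' r bz bz' s g e].
  have [M hM] := contZ _ m m bz (gd _ _ g).
  by exists M => z' bz' s e; rewrite !infT //; [apply: hM | apply: gS s g].
apply: (injZ _ _ r _ bz bz' s (gd _ _ g)).
by rewrite -!infT //; apply: gS s g.
Qed.

End InfiniteComposition.

Lemma prefix_take_le (X : eqType) (s t : seq X) m n :
  m <= n -> prefix (take n s) t -> prefix (take m s) (take m t).
Proof.
move=> mn /prefixP[u ->]; rewrite -(take_takel s mn) take_cat.
case: ltnP => [lt|ge]; first exact: prefix_refl.
by rewrite (take_oversize ge) prefix_prefix.
Qed.

(** * Infinite composition of embeddings *)

Section InfiniteEmbedding.
Variables (k : nat) (H : nat -> tree -> tree).
Hypothesis opH : forall n, oper (k + n) (H n).
Variables (T : tree) (psi : nat -> seq sym -> seq sym).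
Hypothesis pT : pclosed T.
Hypothesis emb : forall n, embeds (k + n) (icomp H n.+1 T) (icomp H n T) (psi n).

Fixpoint phi (n c : nat) (s : seq sym) : seq sym :=
  if c is c'.+1 then psi n (phi n.+1 c' s) else s.
(** [T] and [icomp H (n + size s) T] agree up to the length of [s], so a string of [T] can enter the
    chain of maps at that step. *)
Definition ipsi (n : nat) (s : seq sym) : seq sym := phi n (size s) s.

Lemma phi_in n c s : icomp H (n + c) T s -> icomp H n T (phi n c s).
Proof.
elim: c n => [|c IH] n /=; first by rewrite addn0.
by have [[h1 _ _ _] _] := emb n => Ts; apply: h1; apply: IH; rewrite addSn -addnS.
Qed.

Lemma phi_mono n c s s' : icomp H (n + c) T s' -> prefix s s' ->
  prefix (phi n c s) (phi n c s').
Proof.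
elim: c n => [|c IH] n //= Ts ps; have [[_ h2 _ _] _] := emb n.
have Ts' : icomp H (n.+1 + c) T s' by rewrite addSn -addnS.
by apply: h2; [apply: phi_in | apply: IH].
Qed.

Lemma phi_k n c s : icomp H (n + c) T s ->
  size s <= size (phi n c s) /\ prefix (take (k + n) s) (phi n c s).
Proof.
elim: c n => [|c IH] n /=; first by split=> //; apply: prefix_take.
move=> Ts; have Ts' : icomp H (n.+1 + c) T s by rewrite addSn -addnS.
have [le p] := IH _ Ts'; have [[_ _ h3 _] _] := emb n.
have [le1 p1] := h3 _ (phi_in Ts'); split; first exact: leq_trans le le1.
by apply: prefix_trans p1; apply: prefix_take_le p; lia.
Qed.

Lemma phi_snd n c s s' : icomp H (n + c) T s -> icomp H (n + c) T s' ->
  map snd s = map snd s' -> map snd (phi n c s) = map snd (phi n c s').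
Proof.
elim: c n => [|c IH] n //= Ts Ts' e; have [[_ _ _ h4] _] := emb n.
have e' : n + c.+1 = n.+1 + c by lia.
by rewrite e' in Ts Ts'; apply: h4; [apply: phi_in | apply: phi_in | apply: IH].
Qed.

Lemma phiD n c d s : phi n (c + d) s = phi n c (phi (n + c) d s).
Proof.
by elim: c n => [|c IH] n /=; [rewrite addn0 | rewrite IH addSn -addnS].
Qed.

Lemma icompT n s : size s <= k + n -> T s -> icomp H n T s.
Proof. by move=> le Ts; apply/(icomp_k opH). Qed.

Lemma ipsi_pre n : preembeds (k + n) T (icomp H n T) (ipsi n).
Proof.
split.
- by move=> s Ts; apply: phi_in; apply: icompT => //; lia.
- move=> s s' Ts' ps; have le := size_prefix ps.
  have Ts'' : icomp H (n + size s + (size s' - size s)) T s' by apply: icompT => //; lia.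
  have [_ p] := phi_k Ts''.
  rewrite /ipsi -[size s' in X in prefix _ X](subnKC le) phiD; apply: phi_mono; first exact: phi_in.
  apply: prefix_trans p; move: ps; rewrite prefixE => /eqP{1}<-.
  by rewrite -(@take_takel _ (size s) (k + (n + size s))); [apply: prefix_take | lia].
- by move=> s Ts; apply: phi_k; apply: icompT => //; lia.
- move=> s s' Ts Ts' e; have sz : size s = size s'.
    by rewrite -[LHS](size_map snd) e size_map.
  by rewrite /ipsi sz; apply: phi_snd => //; apply: icompT => //; lia.
Qed.

Lemma ext_ipsi n z : br T z -> ext (ipsi n) z = ext (psi n) (ext (ipsi n.+1) z).
Proof.
move=> bz; apply: pre_inj => m.
have [pe _] := emb n; have pT' i : pclosed (icomp H i T) by apply: icomp_pclosed.
have bZ := ext_br (pT' n.+1) (ipsi_pre n.+1) bz.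
set Z1 := ext (ipsi n.+1) z in bZ *; set M := size (ipsi n.+1 (pre z m)).
have eZ : pre Z1 M = ipsi n.+1 (pre z m) by exact: (ext_pre_size (ipsi_pre n.+1) m bz).
have mM : m <= M.
  by have [_ _ h _] := ipsi_pre n.+1; have [] := h _ (bz m); rewrite size_pre.
(* [ipsi] uses as many maps as its argument has entries; one further entry of [z] makes room for
   [psi n] in front of the maps used by [ipsi n.+1]. *)
have /prefixP[t et] : prefix (psi n (ipsi n.+1 (pre z m))) (ipsi n (pre z m.+1)).
  rewrite /ipsi !size_pre /=; have [[_ h2 _ _] _] := emb n; apply: h2.
    by apply: phi_in; apply: icompT => //; rewrite size_pre; lia.
  apply: phi_mono; last exact: prefix_pre.
  by apply: icompT => //; rewrite size_pre; lia.
have e1 : pre (ext (ipsi n) z) m = take m (ipsi n (pre z m.+1)).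
  apply: (ext_pre (ipsi_pre n)) => //.
  by have [_ _ h _] := ipsi_pre n; have [] := h _ (bz m.+1); rewrite size_pre; lia.
have [_ _ h3 _] := pe; have [le _] := h3 _ (bZ M); rewrite size_pre in le.
have e2 : pre (ext (psi n) Z1) m = take m (psi n (pre Z1 M)).
  by apply: (ext_pre pe) => //; apply: leq_trans le.
rewrite e1 e2 et eZ takel_cat //; rewrite -eZ; exact: leq_trans le.
Qed.

(** Equality of two images descends through the injective maps to every later step, and
    [ipsi (n + d)] fixes the first [k + (n + d)] entries, so the points agree to every length. *)
Lemma ipsi_embeds n : embeds (k + n) T (icomp H n T) (ipsi n).
Proof.
split; first exact: ipsi_pre.
move=> z z' bz bz' s e; have pT' i : pclosed (icomp H i T) by apply: icomp_pclosed.
have eq d : ext (ipsi (n + d)) z = ext (ipsi (n + d)) z'.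
  elim: d => [|d IH]; first by rewrite addn0.
  have [_ h5] := emb (n + d); rewrite addnS; apply: h5.
  - exact: ext_br (ipsi_pre _) _ bz.
  - exact: ext_br (ipsi_pre _) _ bz'.
  - exact: (ext_sect (ipsi_pre (n + d).+1) bz bz' s).
  - by rewrite -!ext_ipsi.
apply: pre_inj => d; have le : d <= k + (n + d) by lia.
apply: (pre_le le); rewrite -(ext_k (ipsi_pre (n + d)) bz).
by rewrite -(ext_k (ipsi_pre (n + d)) bz') eq.
Qed.

End InfiniteEmbedding.

(** * Climbing the Borel hierarchy *)

Section Hierarchy.
Variable lt : nat -> nat -> Prop.

Definition cylopen (P : pts -> Prop) : Prop :=
  forall z, P z -> exists n, forall z', pre z n = pre z' n -> P z'.

(** The classes [Sigma0] transferred to sets of points, with open sets described by prefixes. *)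
Inductive sigma : nat -> (pts -> Prop) -> Prop :=
  | sigma_open i P : cylopen P -> sigma i P
  | sigma_union i (P : nat -> pts -> Prop) (j : nat -> nat) :
      (forall n, lt (j n) i) -> (forall n, sigma (j n) (fun z => ~ P n z)) ->
      sigma i (fun z => exists n, P n z).

Lemma sigma_ext i P psi : sigma i P -> sigma i (P \o ext psi).
Proof.
elim=> {i P} [i P oP|i P j lj _ IH].
  apply: sigma_open => z /oP[n hn]; exists n => z' e.
  by apply: hn; apply: ext_pre_eq.
exact: (@sigma_union i (fun n => P n \o ext psi) j lj IH).
Qed.

Lemma sigma_inv i P : sigma i P -> cylopen P \/
  exists (Q : nat -> pts -> Prop) (j : nat -> nat),
  [/\ forall n, lt (j n) i, forall n, sigma (j n) (Q n) &
      forall z, P z <-> exists n, ~ Q n z].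
Proof.
case=> [{}i {}P oP|{}i {}P j lj sj]; first by left.
right; exists (fun n z => ~ P n z), j; split=> // z.
by split=> -[n]; [exists n | move/contrapT; exists n].
Qed.

Definition opens (k : nat) (C : (pts -> Prop) -> Prop) (H : tree -> tree) : Prop :=
  forall T, pclosed T -> forall P : nat -> pts -> Prop, (forall j, C (P j)) ->
  exists psi, embeds k T (H T) psi /\ forall j, relopen T (P j \o ext psi).

Hypothesis jump : forall k, exists H, oper k H /\
  forall T, pclosed T -> forall P : nat -> pts -> Prop,
  (forall j, relopen (H T) (P j)) ->
  exists psi, embeds k T (H T) psi /\ forall j, locconst T (P j \o ext psi).

(** Induction on [i]. A set of the class that is not open is a union of complements of sets of lower
    classes. One operator treats all the sets of one lower class at once, so an infinite composition
    treats them all. *)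
Lemma hierarchy_opens : well_founded lt -> forall i k,
  exists H, oper k H /\ opens k (sigma i) H.
Proof.
move=> wf; elim/(well_founded_ind wf) => i IH k.
have [J /all_and2[opJ hJ]] := choice jump.
have /choice[L hL] : forall jk : nat * nat, exists H, oper jk.2 H /\
    opens jk.2 (fun P => cylopen P \/ lt jk.1 i /\ sigma jk.1 P) H.
  move=> [j k'] /=; have [l|nl] := pselect (lt j i).
    have [H [oH hH]] := IH j l k'; exists H; split=> // T pT P hP.
    by apply: hH => // n; have [/sigma_open|[]] := hP n.
  exists id; split=> [|T pT P hP]; first exact: oper_id.
  have e z : ext id z = z by apply/funext => n; rewrite /ext nth_pre.
  exists id; split; first (split; first split) => //.
  - by move=> s Ts; split=> //; apply: prefix_take.
  - by move=> z z' _ _ _; rewrite !e.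
  move=> n z bz; rewrite /= e => Pz; have [op|[]//] := hP n; have [m hm] := op _ Pz.
  by exists m => z' bz' ez; rewrite /= e; apply: hm.
(* Step 2j makes the sets of class j relatively open, step 2j+1 then makes them
   relatively clopen; a union of complements of such sets becomes open. *)
pose K n := if odd n then J (k + n) else L (n./2, k + n).
have opK n : oper (k + n) (K n).
  by rewrite /K; case: ifP => _; [apply: opJ | have [] := hL (n./2, k + n)].
exists (icomp K 0); split.
  split=> [m T T'|T|T|T].
  - exact: icomp_mono.
  - by have := @icomp_k _ _ opK 0 T; rewrite addn0.
  - exact: icomp_pclosed.
  - exact: icomp_fibred.
move=> T pT P sP.
have /choice[Q /choice[j hQ]] : forall l, exists Q : nat -> pts -> Prop, exists j : nat -> nat,
   (forall n, lt (j n) i /\ sigma (j n) (Q n)) /\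
   (forall z, P l z <-> exists n, ~ Q n z) \/ cylopen (P l).
  move=> l; case: (sigma_inv (sP l)) => [op|[Q [j [h1 h2 h3]]]].
    by exists (fun _ _ => True), (fun _ => 0); right.
  by exists Q, j; left; split.
pose dp c := odflt (0, 0) (unpickle c : option (nat * nat)).
pose R0 c := Q (dp c).1 (dp c).2; pose jj c := j (dp c).1 (dp c).2.
(* The family treated at step [n] depends on the earlier embeddings, so an embedding is chosen in
   advance for every possible family. *)
have /choice[ps hps] : forall nF : nat * (nat -> pts -> Prop), exists psi,
    [/\ embeds (k + nF.1) (icomp K nF.1.+1 T) (icomp K nF.1 T) psi,
        ~~ odd nF.1 -> forall c, lt nF.1./2 i -> sigma nF.1./2 (nF.2 c) ->
          relopen (icomp K nF.1.+1 T) (nF.2 c \o ext psi) &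
        odd nF.1 -> forall c, relopen (icomp K nF.1 T) (nF.2 c) ->
          locconst (icomp K nF.1.+1 T) (nF.2 c \o ext psi)].
  move=> [n F] /=; have pT' := @icomp_pclosed _ _ opK n.+1 _ pT.
  rewrite (icompS opK n); case e : (odd n).
    (* [F' c] is [F c] when that set is relatively open and everything otherwise, so that the jump
       applies to the whole family. *)
    pose F' c z := relopen (K n (icomp K n.+1 T)) (F c) -> F c z.
    have rF c : relopen (K n (icomp K n.+1 T)) (F' c).
      have [r|nr] := pselect (relopen (K n (icomp K n.+1 T)) (F c)).
        by move=> z bz /(_ r)/(r _ bz)[m hm]; exists m => z' bz' ez _; apply: hm.
      by move=> z _ _; exists 0 => z' _ _ r.
    have := hJ (k + n) _ pT' F'; have eK : K n = J (k + n) by rewrite /K e.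
    rewrite -eK.
    move=> /(_ rF)[psi [h1 h2]].
    exists psi; split=> // _ c r z bz; have [m hm] := h2 c _ bz.
    exists m => z' bz' ez; have [h3 h4] := hm _ bz' ez.
    by split=> h; [apply: h3 | apply: h4].
  pose F' c z := lt n./2 i -> sigma n./2 (F c) -> F c z.
  have [_ hO] := hL (n./2, k + n).
  have eK : K n = L (n./2, k + n) by rewrite /K e.
  rewrite -eK in hO.
  have [|psi [h1 h2]] := hO _ pT' F'.
    move=> c; have [[l s]|nl] := pselect (lt n./2 i /\ sigma n./2 (F c)).
      right; split=> //=; suff -> : F' c = F c by [].
      by apply/funext => z; apply/propext; split=> [h|h _ _]; [exact: h l s|].
    by left=> z _; exists 0 => z' _ l s; case: nl.
  exists psi; split=> // _ c l s z bz Fz.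
  have [m hm] := h2 c z bz (fun _ _ => Fz); exists m => z' bz' ez.
  exact: hm bz' ez l s.
(* [Fs n c] is [R0 c] pulled back along the first [n] embeddings. *)
pose Fs := fix Fs n := if n is m.+1 then
  fun c => Fs m c \o ext (ps (m, Fs m)) else R0.
pose psi n := ps (n, Fs n).
have emb n : embeds (k + n) (icomp K n.+1 T) (icomp K n T) (psi n).
  by have [] := hps (n, Fs n).
pose Psi := ipsi psi 0.
have sF c n : sigma (jj c) (R0 c) -> sigma (jj c) (Fs n c).
  by move=> s; elim: n => [|n IHn] //=; apply: sigma_ext.
have FE c n z : br T z -> Fs n c (ext (ipsi psi n) z) = R0 c (ext Psi z).
  move=> bz; elim: n => [|n <-] //=.
  by rewrite (ext_ipsi opK pT emb n bz).
have lcR c : lt (jj c) i -> sigma (jj c) (R0 c) -> locconst T (R0 c \o ext Psi).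
  move=> l s; pose n := (jj c).*2.
  have [_ h1 _] := hps (n, Fs n); have := h1 _ c _ _.
  rewrite /= odd_double doubleK => /(_ isT l (sF _ _ s)) r.
  have [_ _ h2] := hps (n.+1, Fs n.+1); have := h2 _ c r.
  rewrite /= odd_double => /(_ isT) lc z bz.
  have bZ := ext_br (@icomp_pclosed _ _ opK n.+2 _ pT) (ipsi_pre opK emb n.+2).
  have [m hm] := lc _ (bZ _ bz); exists m => z' bz' ez.
  rewrite /= -(FE c n.+2 z bz) -(FE c n.+2 z' bz'); apply: hm; first exact: bZ.
  exact: ext_pre_eq.
exists Psi; split; first by have := ipsi_embeds opK pT emb 0; rewrite addn0.
move=> l z bz /= Pz; case: (hQ l) => [[h1 h2]|op]; last first.
  by have [n hn] := op _ Pz; exists n => z' bz' e; apply: hn; apply: ext_pre_eq.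
have [m nQ] := (h2 _).1 Pz; pose c := pickle (l, m).
have [l1 s1] := h1 m; have := lcR c; rewrite /R0 /jj /dp pickleK /= => /(_ l1 s1).
move=> /(_ _ bz)[n hn]; exists n => z' bz' e; apply/h2; exists m => Qz.
by apply: nQ; apply/(hn _ bz' e).
Qed.
End Hierarchy.

(** * The jump: a machine with sleeping threads *)

(* The priority ordering of strings; proper prefixes have smaller rank. *)
Definition rank (s : seq sym) : nat := pickle (rev s).

(** Reversal puts the new symbol first, and a list with head [n] and tail coded by [m] has code
    [2 ^ n * m.*2.+1], which exceeds [m]. *)
Lemma rank_rcons s a : rank s < rank (rcons s a).
Proof.
rewrite /rank rev_rcons /pickle /= /choice.pickle_seq /=.
set m := CodeSeq.code _; set n := pickle a.
have : 0 < 2 ^ n by rewrite expn_gt0.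
by case: (2 ^ n) => // e _; rewrite mulSn; lia.
Qed.

Lemma rank_inj : injective rank.
Proof. by move=> s t /(pcan_inj pickleK) /(can_inj revK). Qed.

Lemma rank_take s m n : m < n <= size s -> rank (take m s) < rank (take n s).
Proof.
elim: n => [|n IH] // /andP[mn ns].
rewrite (take_nth (0, 0)) //; have := rank_rcons (take n s) (nth (0, 0) s n).
have [->|ne] := eqVneq m n; first by [].
by apply: ltn_trans; apply: IH; lia.
Qed.

Lemma size_rank s : size s <= rank s.
Proof.
elim/last_ind: s => [|s a IH] //; rewrite size_rcons.
exact: leq_ltn_trans IH (rank_rcons s a).
Qed.

(* The parameter entry [c] is an instruction: [None] raises the level by one,
   [Some (i, og)] resets it to a smaller level [i], where [og = Some (g, m)]
   keeps awake only the thread with past [g], cut to length [m].  The other entry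
   is a number by which the thread may grow ([inl]) or a time until which it
   sleeps ([inr]). *)
Definition instr (c : nat) : option (nat * option (seq nat * nat)) :=
  odflt None (unpickle c).
Definition ysym (c : nat) : nat + nat := if odd c then inr c./2 else inl c./2.

Lemma instrK v : instr (pickle v) = v. Proof. by rewrite /instr pickleK. Qed.
Lemma ysym_grow b : ysym b.*2 = inl b.
Proof. by rewrite /ysym odd_double doubleK. Qed.
Lemma ysym_sleep q : ysym q.*2.+1 = inr q.
Proof. by rewrite /ysym /= odd_double uphalf_double. Qed.
Lemma ysym_inj : injective ysym.
Proof.
move=> c d; rewrite /ysym; have := odd_double_half c; have := odd_double_half d.
by case: (odd c); case: (odd d) => // ed ec [e]; rewrite -ed -ec e.
Qed.

(* [Awake u] simulates the string [u] of the tree; [Asleep j u q] simulates [u],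
   stopped at level [j], and can wake only by a reset to level [j] at time [q]. *)
Inductive status := Dead | Awake of seq sym | Asleep of nat & seq sym & nat.

Section Machine.
Variable k : nat.

Definition level (x : seq nat) : nat :=
  foldl (fun l c => if instr c is Some (i, _) then i else l.+1) k (drop k x).
Definition resets (x : seq nat) (i : nat) : nat :=
  count (fun c => if instr c is Some (i', _) then i' == i else false) (drop k x).
(* The number of resets at level [j] tells the [j]-th parameter entry of the
   simulated string.  Every value recurs as the resets accumulate. *)
Definition told (x : seq nat) (j : nat) : nat := logn 2 (resets x j).

Lemma level_rcons x a : k <= size x -> level (rcons x a) =
  if instr a is Some (i, _) then i else (level x).+1.
Proof. by move=> kx; rewrite /level drop_rcons // foldl_rcons. Qed.

Lemma level_small x : size x <= k -> level x = k.
Proof. by move=> xk; rewrite /level drop_oversize. Qed.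

Lemma resets_rcons x a j : k <= size x -> resets (rcons x a) j =
  resets x j + (if instr a is Some (i, _) then i == j else false).
Proof.
by move=> kx; rewrite /resets drop_rcons // -cats1 count_cat /= addn0; case: (instr a) => [[]|].
Qed.

(** Ranks increase along a branch, so each branch has exactly one initial segment of this kind: the
    strings that can be awake at level [l] form a front. *)
Definition frontier (l : nat) (u : seq sym) : Prop :=
  [/\ k <= size u, forall m, k <= m < size u -> rank (take m u) < l & l <= rank u].

Lemma frontier_inj l u v w : frontier l u -> frontier l v ->
  prefix u w -> prefix v w -> u = v.
Proof.
have le_ u' v' : frontier l u' -> frontier l v' -> prefix u' w -> prefix v' w ->
    size u' <= size v'.
  rewrite !prefixE => -[h1 h2 h3] [h4 h5 h6] /eqP e /eqP e'.
  rewrite leqNgt; apply/negP => lt; have := h2 (size v').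
  rewrite h4 lt => /(_ isT); rewrite -e take_takel ?(ltnW lt) // e'.
  by move=> h7; have := leq_trans h7 h6; rewrite ltnn.
move=> fu fv pu pv; have e : size u = size v.
  by apply/eqP; rewrite eqn_leq (le_ u v) // (le_ v u).
by move: pu pv; rewrite !prefixE e => /eqP e1 /eqP e2; rewrite -e1 e2.
Qed.

Lemma frontier_take l s : k <= size s -> l <= rank s ->
  exists m, k <= m <= size s /\ frontier l (take m s).
Proof.
move=> ks ls; have [|m [/andP[/andP[km ms] lm] hm]] :=
    @ex_least (fun m => (k <= m <= size s) && (l <= rank (take m s))).
  by exists (size s); rewrite ks leqnn take_size.
exists m; rewrite km ms; split=> //; split=> //; first by rewrite size_takel.
move=> j; rewrite size_takel // => /andP[kj jm]; rewrite take_takel ?(ltnW jm) //.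
rewrite ltnNge; apply/negP => lj; have := hm j.
rewrite kj lj (leq_trans (ltnW jm) ms) => /(_ isT); lia.
Qed.

Variable T : tree.

(** An awake string grows when the level rises past its rank. Only the designated thread survives a
    reset while awake. The test [rank u != i] kills a sleeper with the string of rank [i] when
    another thread is designated to carry that string, so that contents identify threads. *)
Definition step (s : seq sym) (st : status) (a : sym) : status :=
  match st with
  | Dead => Dead
  | Awake u =>
    match instr a.2 with
    | None =>
      match ysym a.1 with
      | inr q => if size s < q then Asleep (level (map snd s)) u q else Dead
      | inl b =>
        if rank u == level (map snd s) then
          let u' := rcons u (b, told (map snd s) (size u)) in
          if `[< T u' >] then Awake u' else Dead
        else if b == 0 then Awake u else Dead
      end
    | Some (i, Some (g, m)) =>
      if [&& i < level (map snd s), a.1 == 0, g == map fst s, k <= m <= size u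
           & rank (take m u) == i] then Awake (take m u) else Dead
    | Some (_, None) => Dead
    end
  | Asleep j u q =>
    match instr a.2 with
    | None => if (size s < q) && (a.1 == 0) then st else Dead
    | Some (i, og) =>
      if (i < level (map snd s)) && (a.1 == 0) then
        if i == j then
          if (q == size s) && ((rank u != i) || (og == None)) then Awake u else Dead
        else if (j < i) && (size s < q) then st else Dead
      else Dead
    end
  end.

Fixpoint runr (r : seq sym) : status :=
  if r is a :: r' then
    if size r' < k then (if `[< T (rev r) >] then Awake (rev r) else Dead)
    else step (rev r') (runr r') a
  else if `[< T [::] >] then Awake [::] else Dead.
Definition run (s : seq sym) : status := runr (rev s).

Lemma run_small s : size s <= k -> run s = if `[< T s >] then Awake s else Dead.
Proof.
rewrite /run; elim/last_ind: s => [|s a _] //; rewrite size_rcons => sk.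
by rewrite rev_rcons /= size_rev sk rev_cons revK.
Qed.

Lemma run_rcons s a : k <= size s -> run (rcons s a) = step s (run s) a.
Proof. by move=> ks; rewrite /run rev_rcons /= size_rev ltnNge ks revK. Qed.

Definition alive (s : seq sym) : Prop := run s <> Dead.

Definition content_ok (s u : seq sym) : Prop :=
  [/\ T u, size u <= size s, take k u = take k s &
      forall m, k <= m < size u -> (nth (0, 0) u m).2 = told (map snd s) m].

Definition inv (s : seq sym) : Prop :=
  match run s with
  | Dead => True
  | Awake u => [/\ k <= level (map snd s) <= size s,
      frontier (level (map snd s)) u & content_ok s u]
  | Asleep j u q => [/\ k <= j < level (map snd s), level (map snd s) <= size s,
      size s <= q, frontier j u & content_ok s u]
  end.

Hypothesis pT : pclosed T.

(** A position [m >= k] of [u] satisfies [m <= rank (take m u) < j], so a reset to a level at least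
    [j] leaves the entries already told unchanged. *)
Lemma take_prefix_told s a u j : k <= size s -> frontier j u -> content_ok s u ->
  (forall i og, instr a.2 = Some (i, og) -> j <= i) -> content_ok (rcons s a) u.
Proof.
move=> ks [h1 h2 h3] [c1 c2 c3 c4] hi; split=> //.
- by rewrite size_rcons; apply: leqW.
- by rewrite -cats1 takel_cat.
move=> m mu; rewrite c4 // /told map_rcons resets_rcons ?size_map //.
case e : (instr a.2) => [[i og]|]; last by rewrite addn0.
have ji := hi _ _ e; have lj := h2 m mu; have := size_rank (take m u).
rewrite size_takel; last by case/andP: mu => _ /ltnW.
by move=> mr; rewrite (_ : i == m = false) ?addn0 //; apply/eqP; lia.
Qed.

Lemma inv_base s : size s = k -> inv s.
Proof.
move=> e; rewrite /inv run_small ?e //; case: asboolP => // Ts.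
rewrite level_small ?size_map ?e // ?leqnn; split=> //.
  by split; [rewrite e | move=> m; rewrite e => /andP[]; lia | rewrite -e size_rank].
by split=> // m; rewrite e => /andP[]; lia.
Qed.

Lemma invP s : k <= size s -> inv s.
Proof.
elim/last_ind: s => [|s a IH]; last first.
  have [/inv_base //|ne] := eqVneq (size (rcons s a)) k.
  rewrite leq_eqVlt eq_sym (negbTE ne) size_rcons ltnS => /= ks.
  move: (IH ks); rewrite /inv run_rcons //.
  have lv : k <= size (map snd s) by rewrite size_map.
  case: (run s) => [|u|j u q] //=.
    move=> [/andP[l1 l2] fu cu]; rewrite map_rcons level_rcons //.
    case e : (instr a.2) => [[i [[g m]|]]|] //.
      case: ifP => // /and5P[li _ _ /andP[km mu] /eqP ei].
      have [h1 h2 h3] := fu.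
      have fi : frontier i (take m u).
        split; rewrite ?ei ?size_takel // => n /andP[kn nm].
        by rewrite take_takel ?(ltnW nm) // -ei; apply: rank_take; rewrite nm.
      have ki : k <= i.
        by rewrite -ei; apply: leq_trans (size_rank _); rewrite size_takel.
      rewrite size_rcons ki; split=> //; first lia.
      apply: (@take_prefix_told _ _ _ i) => //; last by move=> ? ?; rewrite e => -[->].
      have [c1 c2 c3 c4] := cu; split.
      - exact: pclosed_take.
      - by rewrite size_takel //; lia.
      - by rewrite take_takel // c3.
      - move=> n; rewrite size_takel // => /andP[kn nm].
        by rewrite nth_take // c4 // kn; lia.
    have cu' : content_ok (rcons s a) u.
      by apply: take_prefix_told fu cu _ => // i og; rewrite e.
    case: (ysym a.1) => [b|q]; last first.
      by case: ifP => // sq; rewrite size_rcons l1 ltnSn.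
    have [h1 h2 h3] := fu; case: eqP => [eu|/eqP une]; last first.
      case: ifP => // _; rewrite size_rcons; split=> //.
        by lia.
      split=> //; [by move=> m /h2/leqW|by rewrite ltn_neqAle eq_sym une].
    case: asboolP => // Tu; rewrite size_rcons.
    split; first lia.
      split; rewrite ?size_rcons; first exact: leqW.
        move=> m /andP[km mu]; rewrite -cats1 takel_cat //.
        case: (ltnP m (size u)) => mu'; first by apply/leqW/h2; rewrite km.
        have -> : m = size u by lia.
        by rewrite take_size eu.
      by rewrite -eu rank_rcons.
    have [c1 c2 c3 c4] := cu'; split=> //.
    - by rewrite !size_rcons ltnS; have [] := cu.
    - by rewrite -{1}cats1 takel_cat.
    move=> m; rewrite size_rcons => /andP[km]; rewrite ltnS leq_eqVlt.
    rewrite nth_rcons => /orP[/eqP->|mu]; last by rewrite mu c4 // km.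
    rewrite ltnn eqxx /= /told map_rcons resets_rcons // e addn0 //.
  move=> [/andP[kj jl] ls sq fu cu]; rewrite map_rcons level_rcons //.
  case e : (instr a.2) => [[i og]|]; last first.
    case: ifP => // /andP[sq' _]; rewrite size_rcons.
    split=> //; [by rewrite kj ltnW|].
    by apply: take_prefix_told fu cu _ => // ? ?; rewrite e.
  case: ifP => // /andP[il _]; case: eqP => [ij|_].
    case: ifP => // _; rewrite size_rcons ij kj.
    split=> //; first lia.
    by apply: take_prefix_told fu cu _ => // ? ?; rewrite e => -[<- _]; rewrite ij.
  case: ifP => // /andP[ji sq']; rewrite size_rcons.
  split=> //; [by rewrite kj|lia|].
  by apply: take_prefix_told fu cu _ => // ? ?; rewrite e => -[<- _]; apply: ltnW.
by rewrite leqn0 => /eqP e; apply: inv_base; rewrite e.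
Qed.

Lemma alive_rcons s a : alive (rcons s a) -> alive s.
Proof.
rewrite /alive; have [lt|le] := ltnP (size s) k; last first.
  by rewrite run_rcons //; case: (run s).
rewrite !run_small ?size_rcons ?(ltnW lt) //; case: asboolP => // Ta _.
by case: asboolP => // -[]; apply: pT Ta.
Qed.

Lemma alive_take s n : alive s -> alive (take n s).
Proof. exact: (@pclosed_take alive s n alive_rcons). Qed.

Lemma step_awake s st a u : step s st a = Awake u ->
  [\/ [/\ st = Awake u, instr a.2 = None, ysym a.1 = inl 0 & rank u <> level (map snd s)],
      exists v b, [/\ st = Awake v, instr a.2 = None, ysym a.1 = inl b,
        rank v = level (map snd s) & u = rcons v (b, told (map snd s) (size v))],
      exists v i g m, [/\ st = Awake v, instr a.2 = Some (i, Some (g, m)),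
        a.1 = 0 /\ g = map fst s, rank u = i & k <= m /\ u = take m v] |
      exists j og, [/\ st = Asleep j u (size s), instr a.2 = Some (j, og), a.1 = 0 &
        rank u <> j \/ og = None]].
Proof.
case: st => [|v|j v q] //=.
  case: (instr a.2) => [[i [[g m]|]]|] //.
    case: ifP => // /and5P[_ /eqP a0 /eqP eg /andP[km _] /eqP ei] [eu].
    by constructor 3; exists v, i, g, m; rewrite -eu.
  case: (ysym a.1) => [b|q]; last by case: ifP.
  case: eqP => [ev|ne].
    by case: asboolP => // Tv [<-]; constructor 2; exists v, b.
  by case: eqP => // -> [<-]; constructor 1.
case: (instr a.2) => [[i og]|]; last by case: ifP.
case: ifP => // /andP[_ /eqP a0]; case: eqP => [ij|_]; last by case: ifP.
case: ifP => // /andP[/eqP eq h] [<-]; constructor 4; exists j, og.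
by rewrite eq -ij; split=> //; case/orP: h => [/eqP|/eqP]; [left | right].
Qed.

Lemma step_asleep s st a j u q : step s st a = Asleep j u q ->
  [/\ st = Awake u, instr a.2 = None, ysym a.1 = inr q & j = level (map snd s) /\ size s < q] \/
  [/\ st = Asleep j u q, a.1 = 0, size s < q &
    forall i og, instr a.2 = Some (i, og) -> j < i].
Proof.
case: st => [|v|j' v q'] //=.
  case: (instr a.2) => [[i [[g m]|]]|] //; first by case: ifP.
  case: (ysym a.1) => [b|q'']; first by case: ifP => _ //; case: ifP.
  by case: ifP => // lt [<- <- <-]; left.
case: (instr a.2) => [[i og]|].
  case: ifP => // /andP[_ /eqP a0]; case: ifP => _; first by case: ifP.
  by case: ifP => // /andP[ji sq] [<- <- <-]; right; split=> // ? ? [<- _].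
by case: ifP => // /andP[sq /eqP a0] [<- <- <-]; right.
Qed.

Lemma eq_pairs (s s' : seq sym) :
  map fst s = map fst s' -> map snd s = map snd s' -> s = s'.
Proof.
by move=> e1 e2; rewrite -[s]zip_unzip -[s']zip_unzip /unzip1 /unzip2 e1 e2.
Qed.

(** Induction on the length, comparing the ways in which one status can arise. Two designated
    threads share the past named by the instruction; a designated and a woken thread exclude each
    other by the test on ranks; a thread falls asleep at the current level, above those of all
    earlier sleepers. *)
Lemma run_uniq s s' : map snd s = map snd s' ->
  (forall u, run s = Awake u -> run s' = Awake u -> s = s') /\
  (forall j u q, run s = Asleep j u q -> run s' = Asleep j u q -> s = s').
Proof.
elim/last_ind: s s' => [|s a IH] s'; case/lastP: s' => [|s' a'].
- by [].
- by move/(congr1 size); rewrite !size_map size_rcons.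
- by move/(congr1 size); rewrite !size_map size_rcons.
rewrite !map_rcons => /rcons_inj[ex ea].
have sz : size s = size s' by rewrite -[LHS](size_map snd) ex size_map.
have [lt|ks] := ltnP (size s) k.
  rewrite !run_small ?size_rcons -?sz //.
  by do 2!case: asboolP => _; split=> // u [<-] [].
have ks' : k <= size s' by rewrite -sz.
rewrite !run_rcons //; have [IH1 IH2] := IH _ ex.
have is_ := invP ks; have is_' := invP ks'.
(* A thread growing out of [v] has [rank v] equal to the level, while a thread already holding the
   longer string has [rank v] below it. *)
have clash v b t u : map snd s = map snd t -> inv t -> run t = Awake u ->
    k <= size v -> rank v = level (map snd s) -> u = rcons v b -> False.
  move=> et; rewrite /inv => /[swap] -> [_ [h1 h2 h3] _] kv ev eu.
  have := h2 (size v); rewrite kv eu size_rcons leqnn => /(_ isT).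
  by rewrite -cats1 take_size_cat // ev et ltnn.
split=> [u|j u q].
  move=> /step_awake[[r1 i1 y1 n1]|[v [b [r1 i1 y1 n1 e1]]]|[v [i [g [m [r1 i1 [y1 g1] n1 [km e1]]]]]]|[j [og [r1 i1 y1 n1]]]];
  move=> /step_awake[[r2 i2 y2 n2]|[v' [b' [r2 i2 y2 n2 e2]]]|[v' [i' [g' [m' [r2 i2 [y2 g2] n2 [km' e2]]]]]]|[j' [og' [r2 i2 y2 n2]]]];
  try (by rewrite ea i2 in i1).
  - by rewrite (IH1 _ r1 r2) (surjective_pairing a) (surjective_pairing a') ea
               (ysym_inj (etrans y1 (esym y2))).
  - exfalso; apply: (clash v' _ s u) r1 _ _ e2 => //; last by rewrite ex.
    by move: is_'; rewrite /inv r2 => -[_ []].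
  - exfalso; apply: (clash v _ s' u) r2 _ _ e1 => //.
    by move: is_; rewrite /inv r1 => -[_ []].
  - rewrite e2 in e1; move/rcons_inj: e1 => [ev eb _].
    rewrite ev in r2; rewrite (IH1 _ r1 r2) (surjective_pairing a) (surjective_pairing a') ea.
    by rewrite eb in y2; rewrite (ysym_inj (etrans y1 (esym y2))).
  - rewrite ea i2 in i1; case: i1 => _ eg _; rewrite eg g1 in g2.
    by rewrite (eq_pairs g2 ex) (surjective_pairing a) (surjective_pairing a') ea y1 y2.
  - exfalso; rewrite ea i2 in i1; case: i1 => ei eog; rewrite eog in n2.
    by case: n2 => // -[]; rewrite n1.
  - exfalso; rewrite ea i2 in i1; case: i1 => ei eog; rewrite -eog in n1.
    by case: n1 => // -[]; rewrite n2.
  - rewrite ea i2 in i1; case: i1 => ei _; rewrite ei -sz in r2.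
    by rewrite (IH2 _ _ _ r1 r2) (surjective_pairing a) (surjective_pairing a') ea y1 y2.
move=> /step_asleep[[r1 i1 y1 [j1 q1]]|[r1 y1 q1 i1]];
move=> /step_asleep[[r2 i2 y2 [j2 q2]]|[r2 y2 q2 i2]].
- by rewrite (IH1 _ r1 r2) (surjective_pairing a) (surjective_pairing a') ea
             (ysym_inj (etrans y1 (esym y2))).
- by move: is_'; rewrite /inv r2 -ex -j1 => -[]; lia.
- by move: is_; rewrite /inv r1 ex -j2 => -[]; lia.
- by rewrite (IH2 _ _ _ r1 r2) (surjective_pairing a) (surjective_pairing a') ea y1 y2.
Qed.

Lemma awake_uniq s s' u : map snd s = map snd s' ->
  run s = Awake u -> run s' = Awake u -> s = s'.
Proof. by move=> /run_uniq[h _]; apply: h. Qed.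

(** A reset to a level at least [l] cannot cut into [c], whose proper prefixes of length at least
    [k] have rank below [l]. *)
Lemma persist_awake s t l c : k <= t <= size s -> alive s ->
  (forall n, t <= n <= size s -> l <= level (map snd (take n s))) ->
  run (take t s) = Awake c -> level (map snd (take t s)) = l ->
  match run s with Awake u => prefix c u | Asleep j u _ => prefix c u && (l <= j)
  | Dead => false end.
Proof.
elim/last_ind: s => [|s a IH].
  by move=> /andP[kt t0] _ _ /= -> _; apply: prefix_refl.
move=> /andP[kt]; rewrite leq_eqVlt => /orP[/eqP->|]; first by rewrite take_size => _ _ -> _; apply: prefix_refl.
rewrite size_rcons ltnS => ts al hl; have al' := alive_rcons al.
rewrite -cats1 !takel_cat // cats1 => rc lc.
have ks : k <= size s by apply: leq_trans ts.
have hl' n : t <= n <= size s -> l <= level (map snd (take n s)).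
  move=> /andP[tn ns]; have := hl n; rewrite tn leqW // => /(_ isT).
  by rewrite -cats1 takel_cat.
have := IH _ al' hl' rc lc; rewrite kt ts => /(_ isT).
have := hl (size s).+1; rewrite leqnn leqW // => /(_ isT).
rewrite take_oversize ?size_rcons // map_rcons level_rcons ?size_map // => hlast.
have hs : l <= level (map snd s) by have := hl' (size s); rewrite ts leqnn take_size; apply.
have fc : frontier l c.
  have kt' : k <= size (take t s) by rewrite size_takel.
  by have := invP kt'; rewrite /inv rc lc => -[].
have := invP ks; rewrite /inv; move: al; rewrite /alive run_rcons //.
case e : (step s (run s) a) => [|u|j u q] // _ is_ IH'.
  move: e => /step_awake[[r1 i1 y1 n1]|[v [b [r1 i1 y1 n1 e1]]]|[v [i [g [m [r1 i1 [y1 g1] n1 [km e1]]]]]]|[j [og [r1 i1 y1 n1]]]].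
  - by rewrite r1 in IH'.
  - by rewrite r1 in IH'; rewrite e1 -cats1; apply: prefix_catl.
  - rewrite r1 in IH'; rewrite i1 in hlast.
    have [le|lt] := leqP (size c) m.
      by rewrite e1; move: IH'; rewrite !prefixE take_takel.
    have ec : take m c = u.
      by move: IH'; rewrite prefixE => /eqP<-; rewrite take_takel // ltnW.
    have [h1 h2 h3] := fc; have := h2 m; rewrite km lt ec n1 => /(_ isT); move: hlast; lia.
  - by rewrite r1 in IH'; case/andP: IH'.
move: e => /step_asleep[[r1 i1 y1 [j1 q1]]|[r1 y1 q1 i1]].
  by rewrite r1 in IH'; rewrite j1 IH'.
by rewrite r1 in IH'.
Qed.

(** Waking takes a reset to exactly the level [j]. *)
Lemma persist_asleep s t j u q : k <= t <= size s -> alive s ->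
  (forall n, t <= n <= size s -> j < level (map snd (take n s))) ->
  run (take t s) = Asleep j u q -> run s = Asleep j u q.
Proof.
elim/last_ind: s => [|s a IH].
  by move=> /andP[kt t0] _ _ /=.
move=> /andP[kt]; rewrite leq_eqVlt => /orP[/eqP->|]; first by rewrite take_size.
rewrite size_rcons ltnS => ts al hl; have al' := alive_rcons al.
rewrite -cats1 !takel_cat // cats1 => rc.
have ks : k <= size s by apply: leq_trans ts.
have IH' : run s = Asleep j u q.
  apply: IH => //; first by rewrite kt.
  move=> n /andP[tn ns]; have := hl n; rewrite tn leqW // => /(_ isT).
  by rewrite -cats1 takel_cat.
have := hl (size s).+1; rewrite leqnn leqW // => /(_ isT).
rewrite take_oversize ?size_rcons // map_rcons level_rcons ?size_map // => hlast.
move: al; rewrite /alive run_rcons // IH'.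
case e : (step s _ a) => [|v|j' v q'] // _.
  move: e => /step_awake[[]//|[v' [b []//]]|[v' [i [g [m []//]]]]|[j' [og [[e1 _ _] i1 _ _]]]].
  by move: hlast; rewrite i1 e1 ltnn.
by move: e => /step_asleep[[]//|[[-> -> ->]]].
Qed.

Lemma alive_reset s a i og : k <= size s -> alive (rcons s a) ->
  instr a.2 = Some (i, og) -> i < level (map snd s).
Proof.
rewrite /alive => ks; rewrite run_rcons // => + e; case: (run s) => [|u|j u q] //=.
  by rewrite e; case: og {e} => [[g m]|] //; case: ifP => // /and5P[].
by rewrite e; case: ifP => // /andP[].
Qed.

(** * Isolation of the branches of the jump *)

Definition lv (z : pts) (t : nat) : nat := level (map snd (pre z t)).

Lemma lvS z t : k <= t -> br alive z -> lv z t.+1 = (lv z t).+1 /\ instr (z t).2 = None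
  \/ lv z t.+1 < lv z t /\ exists og, instr (z t).2 = Some (lv z t.+1, og).
Proof.
move=> kt bz; rewrite /lv preS map_rcons level_rcons; last by rewrite size_map size_pre.
case e : (instr (z t).2) => [[i og]|]; last by left.
right; split; last by exists og.
apply: (alive_reset _ _ e); first by rewrite size_pre.
by rewrite -preS; apply: bz.
Qed.

Lemma lv_sect z z' t : sect z z' -> lv z t = lv z' t.
Proof. by move=> /xs_pre e; rewrite /lv e. Qed.

(** Convergence of the levels to infinity, which is more than their being unbounded. *)
Definition unbounded (z : pts) : Prop :=
  forall i, exists t, forall t', t <= t' -> i < lv z t'.

(* The last visit of [z] to level [i]: the contents at these stages are the
   initial segments of the branch simulated by [z]. *)
Definition stage (z : pts) (i t : nat) (c : seq sym) : Prop :=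
  [/\ k <= t, lv z t = i, forall t', t < t' -> i < lv z t' & run (pre z t) = Awake c].

(** Above level [j] the sleeper cannot wake, and asleep it does not outlive its time [q]. *)
Lemma not_asleep z t j u q : k <= t -> br alive z -> run (pre z t) = Asleep j u q ->
  (forall t', t <= t' -> j < lv z t') -> False.
Proof.
move=> kt bz r h; pose t' := maxn t q.+1.
have le : t <= t' by apply: leq_maxl.
have : run (pre z t') = Asleep j u q.
  apply: (@persist_asleep _ t) => //; rewrite ?size_pre ?take_pre ?kt //.
  by move=> n /andP[tn nt']; rewrite take_pre //; apply: h.
have kt' : k <= size (pre z t') by rewrite size_pre; lia.
by have := invP kt'; rewrite /inv => /[swap] ->; rewrite size_pre => -[]; lia.
Qed.

Lemma stage_ex z i : br alive z -> unbounded z -> k <= i -> exists t c, stage z i t c.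
Proof.
move=> bz uz ki; have [t [ht mt]] := ex_least (uz i).
have lk : lv z k = k by rewrite /lv level_small // size_map size_pre.
have : k < t by rewrite ltnNge; apply/negP => /ht; rewrite lk; lia.
case: t ht mt => // t ht mt; rewrite ltnS => kt.
have le : lv z t <= i.
  rewrite leqNgt; apply/negP => lt; have : t < t; last by rewrite ltnn.
  apply: mt => t'; rewrite leq_eqVlt => /orP[/eqP<-//|]; exact: ht.
have ei : lv z t = i.
  have := ht _ (leqnn t.+1); case: (lvS kt bz) => [[-> _]|[]]; lia.
case r : (run (pre z t)) => [|c|j u q]; first by case: (bz t).
  by exists t, c.
exfalso; apply: (not_asleep kt bz r) => t'; rewrite leq_eqVlt => /orP[/eqP<-|].
  have kt' : k <= size (pre z t) by rewrite size_pre.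
  by have := invP kt'; rewrite /inv r -/(lv z t) => -[/andP[]].
have kt' : k <= size (pre z t) by rewrite size_pre.
move=> /ht; have := invP kt'; rewrite /inv r -/(lv z t) ei => -[/andP[_ ji] _ _ _ _].
exact: ltn_trans.
Qed.

Lemma stage_uniq z i t c t' c' : stage z i t c -> stage z i t' c' -> t = t' /\ c = c'.
Proof.
move=> [_ l1 h1 r1] [_ l2 h2 r2]; suff e : t = t' by move: r2; rewrite -e r1 => -[].
case: (ltngtP t t') => // [/h1|/h2]; [rewrite l2|rewrite l1]; by rewrite ltnn.
Qed.

Lemma stage_sect z z' i t c t' c' : sect z z' -> stage z i t c -> stage z' i t' c' -> t = t'.
Proof.
move=> s [_ l1 h1 r1] [_ l2 h2 r2].
case: (ltngtP t t') => // [/h1|/h2]; rewrite ?(lv_sect _ s) ?l2 ?ltnn //.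
by rewrite -(lv_sect _ s) l1 ltnn.
Qed.

Lemma stage_inv z i t c : stage z i t c -> frontier i c /\ content_ok (pre z t) c.
Proof.
move=> [kt l h r]; have kt' : k <= size (pre z t) by rewrite size_pre.
by have := invP kt'; rewrite /inv r -/(lv z t) l => -[].
Qed.

(** Right after the last visit to [i] the level is [i.+1] and never drops below it again, so the
    content held then persists; at the last visit to [i.+1] the content lies on the same frontier,
    hence is the same. *)
Lemma stage_next z i t c t' c' : br alive z -> stage z i t c -> stage z i.+1 t' c' ->
  prefix c c' /\ (rank c = i -> size c < size c').
Proof.
move=> bz st st'; have [kt l h r] := st; have [kt' l' h' r'] := st'.
have tt' : t < t'.
  by case: (ltngtP t t') => // [/h'|e]; [rewrite l; lia | move: l'; rewrite -e l; lia].
have [l1 n1] : lv z t.+1 = i.+1 /\ instr (z t).2 = None.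
  by have := h _ (ltnSn t); case: (lvS kt bz) => [[->]|[]]; rewrite l //; lia.
have kt1 : k <= t.+1 by apply: leqW.
have [c1 [r1 p1 s1]] : exists c1, [/\ run (pre z t.+1) = Awake c1, prefix c c1 &
    rank c = i -> size c < size c1].
  case e : (run (pre z t.+1)) => [|c1|j u q]; first by case: (bz t.+1).
    exists c1; split=> //; move: e; rewrite preS run_rcons ?size_pre // r.
    - move=> /step_awake[[[->]]|[v [b [[->] _ _ _ ->]]]|[v [i' [g [m [_]]]]]|[j [og []//]]].
      + by rewrite prefix_refl.
      + exact: prefix_rcons.
      + by rewrite n1.
    - move=> /step_awake[[[->]] _ _ + ei|[v [b [[->] _ _ _ ->]]]|[v [i' [g [m [_]]]]]|[j [og []//]]].
      + by rewrite -/(lv z t) l ei.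
      + by rewrite size_rcons.
      + by rewrite n1.
  exfalso; apply: (not_asleep kt1 bz e) => t'' lt.
  move: e; rewrite preS run_rcons ?size_pre // r => /step_asleep[[_ _ _ [-> _]]|[]//].
  by rewrite -/(lv z t) l; apply: h.
suff -> : c' = c1 by [].
have [fc' _] := stage_inv st'.
have := @persist_awake (pre z t') t.+1 i.+1 c1; rewrite size_pre take_pre // r'.
rewrite -/(lv z t.+1) kt1 tt' => /(_ isT (bz t') _ r1 l1) p0.
have {p0} p : prefix c1 c'.
  by apply: p0 => n /andP[tn nt']; rewrite take_pre //; apply: h.
symmetry; apply: (frontier_inj _ fc' p (prefix_refl _)).
have kt1' : k <= size (pre z t.+1) by rewrite size_pre.
by have := invP kt1'; rewrite /inv r1 -/(lv z t.+1) l1 => -[].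
Qed.

Lemma stage_mono z i t c i' t' c' : br alive z -> unbounded z -> k <= i -> i <= i' ->
  stage z i t c -> stage z i' t' c' -> prefix c c'.
Proof.
move=> bz uz ki ii' st; rewrite -(subnKC ii'); elim: (i' - i) t' c' => [|d IH] t' c'.
  by rewrite addn0 => /(stage_uniq st)[_ ->]; apply: prefix_refl.
have [|t1 [c1 st1]] := @stage_ex z (i + d) bz uz; first lia.
rewrite addnS => st'; have [p _] := stage_next bz st1 st'.
by apply: prefix_trans p; apply: IH st1.
Qed.

Lemma stage_large z n : br alive z -> unbounded z -> exists i0, k <= i0 /\
  forall i t c, i0 <= i -> stage z i t c -> n <= size c.
Proof.
move=> bz uz; elim: n => [|n [i0 [ki0 IH]]]; first by exists k.
have [t0 [c0 st0]] := stage_ex bz uz ki0; have le0 := IH _ _ _ (leqnn i0) st0.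
have [[_ _ r0] _] := stage_inv st0.
have kr : k <= rank c0 by apply: leq_trans r0.
exists (rank c0).+1; split=> [|i t c li st]; first exact: leqW.
have [t1 [c1 st1]] := stage_ex bz uz kr.
have [t2 [c2 st2]] := stage_ex bz uz (leqW kr).
have p2 := stage_mono bz uz (leqW kr) li st2 st.
apply: leq_trans (size_prefix p2); have [p s] := stage_next bz st1 st2.
have p01 := stage_mono bz uz ki0 r0 st0 st1; have := size_prefix p01.
rewrite leq_eqVlt => /orP[/eqP e|lt].
  have ec : c0 = c1 by move: p01; rewrite prefixE e take_size => /eqP.
  by apply: leq_ltn_trans le0 _; rewrite ec; apply: s; rewrite -ec.
by apply: leq_ltn_trans le0 _; apply: leq_trans lt _; apply: size_prefix.
Qed.

(** When the levels tend to infinity, [Phi z] is the union of the contents at the last visits. *)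
Lemma jump_fibred : fibred k alive T.
Proof.
have /choice[Phi hPhi] : forall z, exists w : pts, br alive z -> unbounded z ->
    forall i t c, k <= i -> stage z i t c -> pre w (size c) = c.
  move=> z; have [bz|nb] := pselect (br alive z); last by exists z.
  have [uz|nu] := pselect (unbounded z); last by exists z.
  have /choice[C hC] : forall m, exists c, exists i t, k <= i /\ stage z i t c /\ m < size c.
    move=> m; have [i0 [ki0 h]] := stage_large m.+1 bz uz.
    by have [t [c st]] := stage_ex bz uz ki0; exists c, i0, t; have := h _ _ _ (leqnn _) st.
  exists (fun m => nth (0, 0) (C m) m) => _ _ i t c ki st.
  apply: (@eq_from_nth _ (0, 0)); rewrite ?size_pre // => m mc; rewrite nth_pre //.
  have [i' [t' [ki' [st' mC]]]] := hC m; have [le|/ltnW le] := leqP i i'.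
    by have /prefixP[r ->] := stage_mono bz uz ki le st st'; rewrite nth_cat mc.
  by have /prefixP[r ->] := stage_mono bz uz ki' le st' st; rewrite nth_cat mC.
have usect z z' : sect z z' -> unbounded z -> unbounded z'.
  by move=> s uz i; have [t h] := uz i; exists t => t' /h; rewrite (lv_sect _ s).
have big z m : br alive z -> unbounded z -> exists i t c,
    [/\ k <= i, stage z i t c & m <= size c].
  move=> bz uz; have [i0 [ki0 h]] := stage_large m bz uz.
  by have [t [c st]] := stage_ex bz uz ki0; exists i0, t, c; have := h _ _ _ (leqnn _) st.
have prek z : br alive z -> unbounded z -> pre (Phi z) k = pre z k.
  move=> bz uz; have [t [c st]] := stage_ex bz uz (leqnn k).
  have [[kc _ _] [_ _ h _]] := stage_inv st; have [kt _ _ _] := st.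
  by rewrite -(take_pre _ kc) (hPhi z bz uz _ _ _ (leqnn k) st) h take_pre.
exists unbounded, Phi; split=> //.
- by move=> z z' _ _; apply: usect.
(* Here the levels return to the least such [i] infinitely often and are eventually at least [i].
   From [M] on, the content at each return is the one at time [M], and with the section it
   determines the whole past. *)
- move=> z bz /existsNP/ex_least[i [ni mi]].
  have [t0 ht0] : exists t0, forall t, t0 <= t -> i <= lv z t.
    case: i ni mi => [|i] ni mi; first by exists 0.
    by apply: contrapT => /(mi i); rewrite ltnn.
  have low M : exists t, [/\ M <= t, k <= t & lv z t = i].
    move/forallNP: ni => /(_ (maxn M (maxn k t0)))/existsNP[t].
    move=> /not_implyP[le /negP]; rewrite -leqNgt => l; exists t; split; try lia.
    by apply/eqP; rewrite eqn_leq l ht0 //; lia.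
  have [M [M0 kM lM]] := low t0.
  have aw z' : br alive z' -> sect z z' -> exists c, forall t, M <= t -> lv z t = i ->
      run (pre z' t) = Awake c.
    move=> bz' s; have lz' t : t0 <= t -> i <= lv z' t by rewrite -(lv_sect _ s); apply: ht0.
    have iv n : k <= n -> inv (pre z' n) by move=> kn; apply: invP; rewrite size_pre.
    case r : (run (pre z' M)) => [|c|j u q]; first by case: (bz' M).
      exists c => t Mt lt; have := @persist_awake (pre z' t) M i c; rewrite size_pre take_pre // r.
      rewrite -/(lv z' M) -(lv_sect _ s) kM Mt => /(_ isT (bz' t) _ erefl lM) p0.
      have hlv n : M <= n <= t -> i <= level (map snd (take n (pre z' t))).
        by move=> /andP[Mn nt]; rewrite take_pre //; apply: lz'; apply: leq_trans Mn.
      move: (p0 hlv) (iv M kM) (iv t (leq_trans kM Mt)); rewrite /inv r -/(lv z' M) -/(lv z' t).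
      rewrite -!(lv_sect _ s) lM lt; case: (run _) => [|c'|j u q] //.
        by move=> p [_ fc _] [_ fc' _]; rewrite (frontier_inj fc fc' p (prefix_refl _)).
      by move=> /andP[_ ij] _ [/andP[_]]; rewrite ltnNge ij.
    exfalso; apply: (not_asleep kM bz' r) => t Mt; move: (iv M kM).
    rewrite /inv r -/(lv z' M) -(lv_sect _ s) lM => -[/andP[_ ji] _ _ _ _].
    by apply: leq_trans ji _; apply: lz'; apply: leq_trans Mt.
  exists M => z' bz' s e; have [c hc] := aw z bz (sect_refl z).
  have [c' hc'] := aw z' bz' s.
  have ec : c = c'.
    have := hc M (leqnn M) lM; rewrite e hc' // => -[] //.
  apply: pre_inj => n; have [t [Mt kt lt]] := low (maxn M n).
  have nt : n <= t by lia.
  apply: (pre_le nt); apply: (awake_uniq (xs_pre _ s)) (hc _ _ lt) _; first lia.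
  by rewrite ec; apply: hc' => //; lia.
- move=> z bz uz; split; last exact: prek.
  move=> n; have [i [t [c [ki st nc]]]] := big z n bz uz.
  rewrite -(take_pre _ nc) (hPhi z bz uz _ _ _ ki st); apply: pclosed_take => //.
  by have [_ []] := stage_inv st.
- move=> z z' bz bz' s uz j; have [jk|kj] := ltnP j k.
    have /preP -> // := prek z bz uz.
    by have /preP -> // := prek z' bz' (usect _ _ s uz).
  have uz' := usect _ _ s uz.
  have [i1 [ki1 h1]] := stage_large j.+1 bz uz.
  have [i2 [ki2 h2]] := stage_large j.+1 bz' uz'; pose i := maxn i1 i2.
  have ki : k <= i by lia.
  have [t [c st]] := stage_ex bz uz ki; have [t' [c' st']] := stage_ex bz' uz' ki.
  have jc := h1 _ _ _ (leq_maxl _ _) st; have jc' := h2 _ _ _ (leq_maxr _ _) st'.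
  have et := stage_sect s st st'; subst t'.
  have [_ [_ _ _ w]] := stage_inv st; have [_ [_ _ _ w']] := stage_inv st'.
  rewrite -(nth_pre (0, 0) (Phi z) jc) (hPhi z bz uz _ _ _ ki st).
  rewrite -(nth_pre (0, 0) (Phi z') jc') (hPhi z' bz' uz' _ _ _ ki st').
  by rewrite w ?w' ?kj // (xs_pre t s).
split=> [z m bz uz|z z' r bz bz' s uz e].
  have [i [t [c [ki st mc]]]] := big z m bz uz; exists t => z' bz' s e.
  have uz' := usect _ _ s uz; have st' : stage z' i t c.
    have [kt l h rr] := st; split; rewrite -?e -?(lv_sect _ s) // => t' lt.
    by rewrite -(lv_sect _ s); apply: h.
  apply: (pre_le mc).
  by rewrite (hPhi z bz uz _ _ _ ki st) (hPhi z' bz' uz' _ _ _ ki st').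
have [rk|kr] := leqP r k.
  have pr y : br alive y -> unbounded y -> pre (Phi y) r = pre y r.
    by move=> by_ uy; apply: pre_le rk _; apply: prek.
  by rewrite -(pr z) // e pr //; apply: usect s uz.
(* The common prefix [u] of the images is the content of both branches at the last visit to level
   [rank u]. This visit is simultaneous, so the pasts, of length at least [r], coincide. *)
have uz' := usect _ _ s uz; pose u := pre (Phi z) r; pose i := rank u.
have ri : r <= i by rewrite -[r](size_pre (Phi z)); apply: size_rank.
have ki : k <= i by apply: leq_trans ri; apply: ltnW.
have fu : frontier i u.
  split; rewrite ?size_pre //; first exact: ltnW.
  by move=> m /andP[km mr]; rewrite /i -{2}[u]take_size; apply: rank_take; rewrite size_pre mr leqnn.
have key y : br alive y -> unbounded y -> pre (Phi y) r = u -> exists t, stage y i t u.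
  move=> by_ uy eu; have [t [c st]] := stage_ex by_ uy ki; exists t.
  suff <- : c = u by [].
  have [fc _] := stage_inv st; have ec := hPhi y by_ uy _ _ _ ki st.
  apply: (frontier_inj (w := pre (Phi y) (maxn r (size c))) fc fu).
    by rewrite -{1}ec prefix_pre // leq_maxr.
  by rewrite -eu prefix_pre // leq_maxl.
have [t st] := key z bz uz erefl; have [t' st'] := key z' bz' uz' (esym e).
have et := stage_sect s st st'; subst t'.
have [kt l _ r1] := st; have [_ _ _ r2] := st'.
apply: (@pre_le _ _ r t); last exact: (awake_uniq (xs_pre t s) r1 r2).
have kt' : k <= size (pre z t) by rewrite size_pre.
apply: leq_trans ri _; have := invP kt'; rewrite /inv r1 -/(lv z t) l size_pre.
by case=> /andP[].
Qed.

(** Since contents are no longer than the elapsed time, the machine consults only the first [m]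
    levels of [T] on inputs of length up to [m]. *)
Lemma run_size s : (forall u, run s = Awake u -> size u <= size s) /\
  (forall j u q, run s = Asleep j u q -> size u <= size s).
Proof.
elim/last_ind: s => [|s a [IH1 IH2]].
  by rewrite run_small //; case: asboolP => _; split=> // u [<-].
have [lt|ks] := ltnP (size s) k.
  by rewrite run_small ?size_rcons //; case: asboolP => _; split=> // u [<-]; rewrite size_rcons.
rewrite run_rcons //; split=> [u|j u q].
  move=> /step_awake[[/IH1 h _ _ _]|[v [b [/IH1 h _ _ _ ->]]]|[v [i [g [m [/IH1 h _ _ _ [_ ->]]]]]]|[j [og [/IH2 h _ _ _]]]]; rewrite !size_rcons.
  - exact: leqW.
  - by [].
  - by apply/leqW/(leq_trans _ h); rewrite size_take; case: ltnP => // /ltnW.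
  - exact: leqW.
by move=> /step_asleep[[/IH1 h _ _ _]|[/IH2 h _ _ _]]; rewrite size_rcons leqW.
Qed.

End Machine.

Lemma run_agree k m T T' s : tagree m T T' -> size s <= m -> run k T s = run k T' s.
Proof.
move=> h; elim/last_ind: s => [|s a IH].
  by move=> s0; rewrite !run_small //; congr (if _ then _ else _); apply/asbool_equiv_eq/h.
rewrite size_rcons => sm; have [lt|ks] := ltnP (size s) k.
  by rewrite !run_small ?size_rcons //; congr (if _ then _ else _); apply/asbool_equiv_eq/h; rewrite size_rcons.
rewrite !run_rcons // -IH ?(ltnW sm) //.
have [su _] := run_size k T s; case: (run k T s) su => [|u|j u q] //= su.
case: (instr a.2) => [[i [[g m']|]]|] //; case: (ysym a.1) => [b|q] //.
case: eqP => // _; congr (if _ then _ else _); apply/asbool_equiv_eq/h.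
by rewrite size_rcons; apply: leq_trans sm; rewrite ltnS; apply: su.
Qed.

Lemma jump_oper k : oper k (alive k).
Proof.
split.
- by move=> m T T' h s sm; rewrite /alive (run_agree k h sm).
- by move=> T s sk; rewrite /alive run_small //; case: asboolP.
- by move=> T pT s a; apply: alive_rcons.
- exact: jump_fibred.
Qed.

(** * Parameter strings along which all of [T] is simulated *)

Definition adv : nat := pickle (None : option (nat * option (seq nat * nat))).
Definition reset (i : nat) (og : option (seq nat * nat)) : nat := pickle (Some (i, og)).

Arguments instr : simpl never.
Arguments ysym : simpl never.

Lemma instr_adv : instr adv = None. Proof. exact: instrK. Qed.
Lemma instr_reset i og : instr (reset i og) = Some (i, og). Proof. exact: instrK. Qed.

(** The number [2 ^ a * n.*2.+1] is at least [n] and has 2-adic valuation [a]. *)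
Lemma logn_hit a n : exists d, logn 2 (n + d) = a.
Proof.
exists (2 ^ a * n.*2.+1 - n); rewrite subnKC; last first.
  have : 0 < 2 ^ a by rewrite expn_gt0.
  by case: (2 ^ a) => // e _; rewrite mulSn; lia.
by rewrite lognM ?expn_gt0 // pfactorK // logn_coprime ?addn0 // coprime2n /= odd_double.
Qed.

Section Build.
Variables (k : nat) (T : tree).
Hypothesis pT : pclosed T.
Local Notation run := (run k T).
Local Notation alive := (alive k T).
Local Notation level := (level k).
Local Notation frontier := (frontier k).
Local Notation told := (told k).

Definition above (n : nat) (p q : seq nat) : Prop :=
  prefix p q /\ forall t, size p <= t <= size q -> n <= level (take t q).

Lemma above_refl n p : n <= level p -> above n p p.
Proof.
by move=> h; split=> [|t]; [exact: prefix_refl | rewrite -eqn_leq => /eqP<-; rewrite take_size].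
Qed.

Lemma above_trans n p q r : above n p q -> above n q r -> above n p r.
Proof.
move=> [p1 h1] [p2 h2]; split=> [|t /andP[pt tr]]; first exact: prefix_trans p2.
have [qt|tq] := leqP (size q) t; first by apply: h2; rewrite qt.
have := h1 t; rewrite pt (ltnW tq) => /(_ isT); move: p2; rewrite prefixE => /eqP e.
by rewrite -{1}e take_takel // ltnW.
Qed.

Lemma above_le m n p q : m <= n -> above n p q -> above m p q.
Proof. by move=> mn [h1 h2]; split=> // t /h2; apply: leq_trans. Qed.

Lemma above_rcons n p a : k <= size p -> n <= level p ->
  n <= level (rcons p a) -> above n p (rcons p a).
Proof.
move=> kp h1 h2; split=> [|t]; first exact: prefix_rcons.
rewrite size_rcons => /andP[pt]; rewrite leq_eqVlt => /orP[/eqP->|].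
  by rewrite -(size_rcons p a) take_size.
rewrite ltnS => tp; have -> : t = size p by lia.
by rewrite -cats1 take_size_cat.
Qed.

Lemma resets_above n p q j : k <= size p -> above n p q ->
  (forall t, size p < t <= size q -> j < level (take t q)) -> resets k q j = resets k p j.
Proof.
move=> kp [/prefixP[r ->] _]; elim/last_ind: r => [|r a IH]; first by rewrite cats0.
rewrite -rcons_cat => h; rewrite resets_rcons; last by rewrite size_cat; lia.
rewrite IH; last first.
  move=> t /andP[t1 t2]; have := h t; rewrite t1 size_rcons leqW // => /(_ isT).
  by rewrite -cats1 takel_cat.
have := h (size (rcons (p ++ r) a)); rewrite take_size leqnn size_rcons size_cat.
rewrite ltnS leq_addr => /(_ isT); rewrite level_rcons; last by rewrite size_cat; lia.
case: (instr a) => [[i og]|]; last by rewrite addn0.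
by move=> ji; rewrite (_ : i == j = false) ?addn0 //; apply/eqP; lia.
Qed.

(** A thread asleep at time [size p] would have a sleeping level below [level p], hence would still
    be asleep at the end. *)
Lemma awake_above s p c : alive s -> above (level p) p (map snd s) -> k <= size p ->
  run s = Awake c -> exists c', [/\ run (take (size p) s) = Awake c', prefix c' c &
    frontier (level p) c'].
Proof.
move=> al [pp hl] kp rs; have ps := size_prefix pp; rewrite size_map in ps hl.
have ep : map snd (take (size p) s) = p by move: pp; rewrite prefixE map_take => /eqP.
have hl' n : size p <= n <= size s -> level p <= level (map snd (take n s)).
  by rewrite map_take; apply: hl.
have kt : k <= size (take (size p) s) by rewrite size_takel.
have it := invP pT kt; have at_ := @alive_take k T pT s (size p) al.
case r : (run (take (size p) s)) it => [|c'|j u q] // it.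
  exists c'; split=> //; last by move: it; rewrite /inv r ep => -[].
  have := @persist_awake k T pT s (size p) (level p) c'; rewrite kp ps r ep rs.
  by move=> /(_ isT al hl' erefl erefl).
have := @persist_asleep k T pT s (size p) j u q; rewrite kp ps r rs.
have lj : j < level p by move: it; rewrite /inv r ep => -[/andP[]].
by move=> /(_ isT al (fun n h => leq_trans lj (hl' n h)) erefl).
Qed.

Lemma sleep_through p q s u : run s = Awake u -> map snd s = p -> k <= size p ->
  prefix p q -> size p < size q ->
  (forall t, size p < t <= size q -> level p < level (take t q)) ->
  (forall t i og, size p <= t < size q -> instr (nth 0 q t) = Some (i, og) ->
     i < level (take t q)) ->
  exists s', map snd s' = q /\ run s' = Asleep (level p) u (size q).
Proof.
move=> rs ms kp pq lt hl hv; pose d := size q - (size p).+1.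
have szs : size s = size p by rewrite -ms size_map.
suff h e : e <= d -> exists s', map snd s' = take ((size p).+1 + e) q /\
    run s' = Asleep (level p) u (size q).
  have [s' [m' r']] := h d (leqnn d); exists s'; split=> //.
  by rewrite m' take_oversize // /d; lia.
have tp : take (size p) q = p by move: pq; rewrite prefixE => /eqP.
elim: e => [_|e IH ed].
  (* The first entry puts the thread to sleep until time [size q]; all later ones are 0. *)
  exists (rcons s ((size q).*2.+1, nth 0 q (size p))).
  rewrite map_rcons ms addn0 (take_nth 0) // tp; split=> //.
  rewrite run_rcons ?szs // rs /= ysym_sleep szs lt ms.
  case e : (instr _) => [[i og]|] //; have := hv (size p) i og.
  rewrite leqnn lt tp => /(_ isT e); have := hl (size p).+1.
  rewrite ltnSn lt (take_nth 0) // tp level_rcons // e => /(_ isT); lia.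
have [s' [m' r']] := IH (ltnW ed).
have lt' : (size p).+1 + e < size q by rewrite /d in ed; lia.
have szs' : size s' = (size p).+1 + e by rewrite -(size_map snd) m' size_takel // ltnW.
exists (rcons s' (0, nth 0 q ((size p).+1 + e))).
rewrite map_rcons m' addnS [RHS](take_nth 0) //; split=> //.
have ks' : k <= size s' by rewrite szs'; lia.
rewrite run_rcons // r' /= szs' lt' m' eqxx.
case ei : (instr _) => [[i og]|] //; have := hv ((size p).+1 + e) i og.
have kk : k <= size (take ((size p).+1 + e) q) by rewrite size_takel; [lia | exact: ltnW].
have := hl ((size p).+1 + e).+1; rewrite (take_nth 0) // level_rcons //.
rewrite ei lt' andbT => h1 h2; rewrite h2 //=; last by lia.
have lpi : level p < i by apply: h1; lia.
by rewrite gtn_eqF // lpi.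
Qed.

Definition threads (n : nat) (x p : seq nat) : Prop :=
  forall u, T u -> frontier n u -> map snd u = take (size u) x ->
  exists s, map snd s = p /\ run s = Awake u.

(* [p] is a parameter string, at level [size x], along which every string of [T]
   with parameter [x] and right rank can be simulated. *)
Definition built (x p : seq nat) : Prop :=
  [/\ k <= size x <= size p, level p = size x, take k p = take k x,
      forall j, k <= j < size x -> told p j = nth 0 x j & threads (size x) x p].

(** All threads fall asleep for one step and are woken together by an undesignated reset, which adds
    to the count and changes no content. *)
Lemma built_bump x p : built x p -> exists p',
  [/\ built x p', above (size x) p p' & resets k p' (size x) = (resets k p (size x)).+1].
Proof.
move=> [/andP[kx xp] lp tp to th]; pose n := size x.
have kp : k <= size p by apply: leq_trans xp.
have kp' : k <= size (rcons p adv) by rewrite size_rcons leqW.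
have l1 : level (rcons p adv) = n.+1 by rewrite level_rcons // instr_adv lp.
have l2 : level (rcons (rcons p adv) (reset n None)) = n by rewrite level_rcons // instr_reset.
exists (rcons (rcons p adv) (reset n None)); split.
- split=> //.
  + by rewrite kx !size_rcons; lia.
  + by rewrite -!cats1 -catA takel_cat.
  + move=> j /andP[kj jx]; rewrite -to ?kj // /told !resets_rcons // instr_adv instr_reset.
    by rewrite gtn_eqF // !addn0.
  move=> u Tu fu mu; have [s [ms rs]] := th u Tu fu mu.
  have szs : size s = size p by rewrite -ms size_map.
  have ks : k <= size s by rewrite szs.
  pose s1 := rcons s ((size s).+1.*2.+1, adv).
  have r1 : run s1 = Asleep n u (size s).+1.
    by rewrite run_rcons // rs /= ?instr_adv ysym_sleep ltnSn ms lp.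
  exists (rcons s1 (0, reset n None)); rewrite !map_rcons ms; split=> //.
  rewrite run_rcons ?size_rcons ?(leqW ks) // r1 /= ?instr_reset map_rcons ms l1 ltnSn /=.
  by rewrite size_rcons !eqxx orbT.
- apply: above_trans (above_rcons kp _ _) (above_rcons kp' _ _); rewrite ?l1 ?l2 ?lp //.
- by rewrite !resets_rcons // instr_adv instr_reset eqxx addn0 addn1.
Qed.

Lemma built_adjust x p a : built x p -> exists p',
  [/\ built x p', above (size x) p p' & told p' (size x) = a].
Proof.
move=> bp; have [d hd] := logn_hit a (resets k p (size x)).
suff [p' [b' a' r']] : exists p', [/\ built x p', above (size x) p p' &
    resets k p' (size x) = resets k p (size x) + d].
  by exists p'; split=> //; rewrite /told r'.
elim: d {hd} => [|d [p' [b' a' r']]].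
  by exists p; rewrite addn0; split=> //; apply: above_refl; case: bp => _ ->.
have [p'' [b'' a'' r'']] := built_bump b'; exists p''; split=> //.
  exact: above_trans a' a''.
by rewrite r'' r' addnS.
Qed.

(** The thread of [s], cut back to [w], carries [w] from now on. Every other string of the frontier
    sleeps from [p] on and wakes at the reset, since its rank differs from that of [w]. *)
Lemma built_designate x p s u w : built x p -> prefix p (map snd s) -> size p < size s ->
  (forall t, size p < t <= size s -> size x < level (take t (map snd s))) ->
  run s = Awake u -> prefix w u -> k <= size w -> rank w = size x ->
  let c := reset (size x) (Some (map fst s, size w)) in
  [/\ built x (rcons (map snd s) c), above (size x) p (rcons (map snd s) c) &
      run (rcons s (0, c)) = Awake w].
Proof.
move=> [/andP[kx xp] lp tp to th] pq lt hl rs pw kw rw c; set q := map snd s in pq hl *.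
pose n := size x; have szq : size q = size s by rewrite size_map.
have kp : k <= size p by apply: leq_trans xp.
have kq : k <= size q by rewrite szq; lia.
have al : alive s by move=> h; rewrite h in rs.
have lq : n < level q by have := hl (size s); rewrite lt leqnn -szq take_size; apply.
have lr : level (rcons q c) = n by rewrite level_rcons // instr_reset.
have abq : above n p q.
  split=> // t /andP[]; rewrite leq_eqVlt => /orP[/eqP<- _|pt tq]; last first.
    by apply/ltnW/hl; rewrite pt -szq.
  by move: pq; rewrite prefixE => /eqP ->; rewrite lp.
have rw' : run (rcons s (0, c)) = Awake w.
  rewrite run_rcons -?szq // rs /= ?instr_reset lq ?eqxx /= ?eqxx kw (size_prefix pw) /=.
  by move: pw; rewrite prefixE => /eqP->; rewrite rw eqxx.
split=> //; last first.
  by apply: above_trans abq (above_rcons _ _ _); rewrite ?lr // ltnW.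
split=> //.
- by rewrite kx size_rcons szq; lia.
- rewrite -cats1 takel_cat // -tp; move: pq => /prefixP[r ->].
  by rewrite takel_cat.
- move=> j /andP[kj jx]; rewrite -to ?kj // /told resets_rcons // instr_reset gtn_eqF // addn0.
  congr logn; apply: (resets_above kp abq) => t ht.
  by apply: ltn_trans jx _; apply: hl; rewrite -szq.
move=> v Tv fv mv; have [<-|ne] := pselect (w = v).
  by exists (rcons s (0, c)); rewrite map_rcons.
have [s1 [m1 r1]] := th v Tv fv mv.
have [||t i og ht ei|s' [m' r']] := sleep_through r1 m1 kp pq.
- by rewrite szq.
- by move=> t; rewrite szq lp; apply: hl.
- have /andP[pt] := ht; rewrite szq => ts.
  rewrite /q -map_take; apply: (@alive_reset k T (take t s) (nth (0, 0) s t) _ og).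
  + by rewrite size_takel; [apply: leq_trans pt | apply: ltnW].
  + by rewrite -take_nth //; apply: alive_take.
  + by rewrite -ei (nth_map (0, 0)).
exists (rcons s' (0, c)); rewrite map_rcons m'; split=> //.
have szs' : size s' = size q by rewrite -m' size_map.
rewrite run_rcons ?szs' // r' /= ?instr_reset m' lq /= lp eqxx szs' eqxx /=.
by rewrite orbF; case: eqP => // e; case: ne; apply: rank_inj; rewrite rw.
Qed.

(** Raising the level changes the frontier only at the string of rank [size x], which is replaced by
    its one-symbol extensions. *)
Lemma built_finish x p a : built x p -> told p (size x) = a ->
  built (rcons x a) (rcons p adv) /\ above (size x) p (rcons p adv).
Proof.
move=> [/andP[kx xp] lp tp to th] ta; pose n := size x.
have kp : k <= size p by apply: leq_trans xp.
have lr : level (rcons p adv) = n.+1 by rewrite level_rcons // instr_adv lp.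
have to' j : k <= j <= n -> told p j = nth 0 (rcons x a) j.
  move=> /andP[kj]; rewrite leq_eqVlt nth_rcons => /orP[/eqP->|jn].
    by rewrite ltnn eqxx.
  by rewrite jn to // kj.
split; last by apply: above_rcons; rewrite ?lr ?lp.
split=> //.
- by rewrite !size_rcons (leqW kx) ltnS.
- by rewrite size_rcons.
- by rewrite -!cats1 !takel_cat.
- move=> j; rewrite size_rcons ltnS => /to' <-.
  by rewrite /told resets_rcons // instr_adv addn0.
rewrite size_rcons => u Tu [h1 h2 h3] mu.
have szu : size u <= n.+1.
  by have := congr1 size mu; rewrite size_map size_take size_rcons; case: ltnP; lia.
have [hn|/existsNP[m /not_implyP[/andP[km mu'] /negP]]] :=
    pselect (forall m, k <= m < size u -> rank (take m u) < n).
  have un : size u <= n.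
    rewrite leqNgt; apply/negP => lt; have := hn n; rewrite kx lt => /(_ isT).
    by have := size_rank (take n u); rewrite size_takel ?(ltnW lt) //; lia.
  have [s [ms rs]] : exists s, map snd s = p /\ run s = Awake u.
    apply: th => //; first by split=> //; apply: ltnW.
    by rewrite mu -cats1 takel_cat.
  have szs : size s = size p by rewrite -ms size_map.
  exists (rcons s (0, adv)); rewrite map_rcons ms; split=> //.
  rewrite run_rcons ?szs // rs /= ?instr_adv ms lp.
  by rewrite gtn_eqF.
rewrite -leqNgt => nm; have em : rank (take m u) = n.
  by apply/eqP; rewrite eqn_leq nm andbT -ltnS; apply: h2; rewrite km.
have mn : m <= n by have := size_rank (take m u); rewrite size_takel ?(ltnW mu') // em.
have eu : size u = m.+1.
  apply/eqP; rewrite eqn_leq mu' andbT leqNgt; apply/negP => lt.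
  have := h2 m.+1; rewrite lt leqW // => /(_ isT).
  by have := @rank_take u m m.+1; rewrite ltnSn mu' em => /(_ isT); lia.
have [s [ms rs]] : exists s, map snd s = p /\ run s = Awake (take m u).
  apply: th; first exact: pclosed_take.
    split; rewrite ?size_takel ?(ltnW mu') ?em // => j /andP[kj jm].
    by rewrite take_takel ?(ltnW jm) // -/n -em; apply: rank_take; rewrite jm ltnW.
  by rewrite map_take mu size_takel ?(ltnW mu') // take_takel ?(ltnW mu') // -cats1 takel_cat.
have szs : size s = size p by rewrite -ms size_map.
have e : take m.+1 u = u by rewrite -eu take_size.
have en : nth (0, 0) u m = ((nth (0, 0) u m).1, told p m).
  rewrite to' ?km // [LHS]surjective_pairing; congr pair.
  rewrite -(nth_map (0, 0) 0) // mu nth_take //.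
exists (rcons s ((nth (0, 0) u m).1.*2, adv)); rewrite map_rcons ms; split=> //.
rewrite run_rcons ?szs // rs /= ?instr_adv ysym_grow ms lp em eqxx.
rewrite size_takel ?(ltnW mu') // -en -take_nth // e.
by case: asboolP.
Qed.

(** * Deciding one set for one string at each level *)

Section Decide.
Variable fam : nat -> pts -> Prop.

Definition forces (j : nat) (s : seq sym) : Prop :=
  forall z, br alive z -> pre z (size s) = s -> fam j z.

Lemma forces_prefix j s s' : prefix s s' -> forces j s -> forces j s'.
Proof.
move=> ps fs z bz e; apply: fs => //; have le := size_prefix ps.
by move: ps; rewrite -(take_pre z le) e prefixE => /eqP.
Qed.

(** At most one string has rank [size x], and its length fixes [j], so each level settles one
    question. A branch meets the question about the set [j] at its prefix of length [k + j]. *)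
Definition decided (x p : seq nat) : Prop :=
  forall w j, rank w = size x -> size w = k + j -> T w -> frontier (size x) w ->
  map snd w = take (size w) x ->
  (forall s u, map snd s = p -> run s = Awake u -> prefix w u -> forces j s) \/
  (forall s u, above (size x).+1 p (map snd s) -> run s = Awake u -> prefix w u ->
     ~ forces j s).

Lemma stage_build x p a : built x p -> exists p',
  [/\ built (rcons x a) p', above (size x) p p' & decided x p'].
Proof.
move=> bp; have [p1 [b1 a1 t1]] := built_adjust a bp; pose n := size x.
have [/andP[kx xp1] lp1 _ _ _] := b1; have kp1 := leq_trans kx xp1.
have [[w [j [s [u [rw sw [pp lt hl] [ru pw fo]]]]]]|neg] := pselect (exists w j s u,
  [/\ rank w = n, size w = k + j,
      [/\ prefix p1 (map snd s), size p1 < size s &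
        forall t, size p1 < t <= size s -> n < level (take t (map snd s))] &
      [/\ run s = Awake u, prefix w u & forces j s]]); last first.
  have [b2 a2] := built_finish b1 t1.
  exists (rcons p1 adv); split=> //; first exact: above_trans a2.
  move=> w j rw sw Tw fw mw; right=> s u [ps hs] ru pw fo; apply: neg.
  have := size_prefix ps; rewrite size_rcons size_map => lt.
  exists w, j, s, u; split=> //; split=> //.
    by apply: prefix_trans ps; apply: prefix_rcons.
  by move=> t /andP[t1' t2']; apply: hs; rewrite size_rcons t1' size_map.
have kw : k <= size w by rewrite sw leq_addr.
have [b2 a2 r2] := built_designate b1 pp lt hl ru pw kw rw.
set c := reset _ _ in b2 a2 r2.
(* The designating reset is itself counted at level [n], so the entry [a] has to be told anew. *)
have [p3 [b3 a3 t3]] := built_adjust a b2.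
have [b4 a4] := built_finish b3 t3.
exists (rcons p3 adv); split=> //.
  by apply: above_trans a1 _; apply: above_trans a2 _; apply: above_trans a3 a4.
move=> w' j' rw' sw' Tw' fw' mw'.
have ew : w' = w by apply: rank_inj; rewrite rw rw'.
subst w'; have ej : j' = j by lia.
subst j'; left=> s' u' ms' rs' pw'.
have [/andP[_ xp2] lp2 _ _ _] := b2.
have [c' [rc' pc' fc']] : exists c', [/\ run (take (size (rcons (map snd s) c)) s') = Awake c',
    prefix c' u' & frontier (level (rcons (map snd s) c)) c'].
  apply: (awake_above _ _ _ rs'); first by move=> h; rewrite h in rs'.
    by rewrite lp2 ms'; apply: above_trans a3 a4.
  exact: leq_trans kx xp2.
rewrite lp2 in fc'; have ec := frontier_inj fc' fw' pc' pw'; subst c'.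
(* By uniqueness, a thread holding [w] right after the reset is the designated one, so its past
   contains the forcing string. *)
have e : take (size (rcons (map snd s) c)) s' = rcons s (0, c).
  apply: (awake_uniq pT _ rc' r2); rewrite map_rcons map_take ms'.
  have [/prefixP[r ->] _] := above_trans a3 a4.
  by rewrite take_size_cat.
apply: (@forces_prefix j (rcons s (0, c))); first by rewrite -e; apply: prefix_take.
by apply: forces_prefix fo; apply: prefix_rcons.
Qed.

End Decide.
End Build.

(** * The embedding of the branches of [T] into those of its jump *)

Section Embed.
Variables (k : nat) (T : tree).
Hypothesis pT : pclosed T.
Variable fam : nat -> pts -> Prop.
Hypothesis fam_open : forall j, relopen (alive k T) (fam j).

Lemma built_base x : size x = k -> built k T x x.
Proof.
move=> e; split=> //; rewrite ?e ?leqnn //; first by apply: level_small; rewrite e.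
  by move=> j; rewrite ?e => /andP[kj jk]; have := leq_ltn_trans kj jk; rewrite ltnn.
move=> u Tu [h1 h2 h3] mu; exists u; have szu : size u = k.
  have := congr1 size mu; rewrite size_map size_take e; case: ltnP => // lt _.
  by have := leq_ltn_trans h1 lt; rewrite ltnn.
by rewrite mu szu -e take_size run_small ?szu ?e //; case: asboolP.
Qed.

Lemma builder : exists P : seq nat -> seq nat,
  (forall x, size x <= k -> P x = x) /\
  (forall x a, k <= size x -> [/\ built k T x (P x),
     above k (size x) (P x) (P (rcons x a)) & decided k T fam x (P (rcons x a))]).
Proof.
have /choice[next hn] : forall xpa : seq nat * seq nat * nat, exists p',
    built k T xpa.1.1 xpa.1.2 -> [/\ built k T (rcons xpa.1.1 xpa.2) p',
      above k (size xpa.1.1) xpa.1.2 p' & decided k T fam xpa.1.1 p'].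
  move=> [[x p] a] /=; have [b|nb] := pselect (built k T x p).
    by have [p' h] := stage_build pT fam a b; exists p'.
  by exists p.
pose Q := fix Q r := if r is a :: r' then
  if size r' < k then rev r else next (rev r', Q r', a) else [::].
pose P x := Q (rev x).
have Psmall x : size x <= k -> P x = x.
  rewrite /P; elim/last_ind: x => [|x a _] //; rewrite size_rcons => xk.
  by rewrite rev_rcons /= size_rev xk rev_cons revK.
have Prcons x a : k <= size x -> P (rcons x a) = next (x, P x, a).
  by move=> kx; rewrite /P rev_rcons /= size_rev ltnNge kx revK.
have Pbuilt x : k <= size x -> built k T x (P x).
  elim/last_ind: x => [|x a IH] kx.
    by apply: built_base; apply/eqP; rewrite eq_sym -leqn0.
  have [e|ne] := eqVneq (size (rcons x a)) k.
    by rewrite Psmall ?e //; apply: built_base.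
  have kx' : k <= size x by move: kx ne; rewrite size_rcons; lia.
  by rewrite Prcons //; have [] := hn (x, P x, a) (IH kx').
exists P; split=> // x a kx; have [] := hn (x, P x, a) (Pbuilt x kx).
by rewrite -Prcons //= => _ h1 h2; split=> //; apply: Pbuilt.
Qed.

(** For [s] of length at least [k], [psi s] is the thread with parameter [P (map snd s)] that
    simulates the prefix of [s] on the frontier of level [size s]. *)
Lemma jump_embed : exists psi, embeds k T (alive k T) psi /\
  forall j, locconst T (fam j \o ext psi).
Proof.
have [P [Psmall hP]] := builder.
have Pbuilt x : k <= size x -> built k T x (P x) by move=> kx; have [] := hP x 0 kx.
have Pabove x x' : k <= size x -> prefix x x' -> above k (size x) (P x) (P x').
  move=> kx /prefixP[r ->]; elim/last_ind: r => [|r a IH].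
    by rewrite cats0; apply: above_refl; have [_ ->] := Pbuilt x kx.
  rewrite -rcons_cat; apply: above_trans IH _.
  have kxr : k <= size (x ++ r) by rewrite size_cat; apply: leq_trans (leq_addr _ _).
  have [_ h _] := hP _ a kxr; apply: above_le h; rewrite size_cat.
  exact: leq_addr.
have /choice[f hf] : forall s, exists s', T s -> k <= size s ->
    map snd s' = P (map snd s) /\ exists c, [/\ prefix c s, run k T s' = Awake c &
      frontier k (size s) c].
  move=> s; have [[Ts ks]|n] := pselect (T s /\ k <= size s); last first.
    by exists s => Ts ks; case: n.
  have [m [/andP[km ms] fm]] := frontier_take ks (size_rank s).
  have kx : k <= size (map snd s) by rewrite size_map.
  have [_ _ _ _ th] := Pbuilt _ kx; rewrite size_map in th.
  have [|//||s' [ms' rs']] := th (take m s); first exact: pclosed_take.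
    by rewrite size_takel // map_take.
  by exists s' => _ _; split=> //; exists (take m s); split=> //; apply: prefix_take.
pose psi s := if size s < k then s else f s.
have psi_big s : k <= size s -> psi s = f s by rewrite /psi ltnNge => ->.
have psi_small s : size s < k -> psi s = s by rewrite /psi => ->.
have aliveA s c : run k T s = Awake c -> alive k T s by move=> r h; rewrite h in r.
have psi_in s : T s -> alive k T (psi s).
  move=> Ts; have [ks|sk] := leqP k (size s); last first.
    by rewrite psi_small // /alive run_small ?(ltnW sk) //; case: asboolP.
  by rewrite psi_big //; have [_ [c [_ /aliveA]]] := hf s Ts ks.
have psi_size s : T s -> size s <= size (psi s).
  move=> Ts; have [ks|sk] := leqP k (size s); last by rewrite psi_small.
  have [m _] := hf s Ts ks; rewrite psi_big // -[X in _ <= X](size_map snd) m.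
  have kx : k <= size (map snd s) by rewrite size_map.
  by have [/andP[_]] := Pbuilt _ kx; rewrite size_map.
have psi_k s : T s -> k <= size s -> take k (psi s) = take k s.
  move=> Ts ks; rewrite psi_big //; have [_ [c [pc rc [kc _ _]]]] := hf s Ts ks.
  have le := psi_size _ Ts; rewrite psi_big // in le.
  have := invP pT (leq_trans ks le); rewrite /inv rc => -[_ _ [_ _ <- _]].
  by case/prefixP: pc => r ->; rewrite takel_cat.
have psi_mono s s' : T s' -> prefix s s' -> prefix (psi s) (psi s').
  move=> Ts' ps; have le := size_prefix ps; have Ts := pclosed_prefix pT ps Ts'.
  have [ks|sk] := leqP k (size s); last first.
    rewrite (psi_small s) //; have [ks'|sk'] := leqP k (size s'); last by rewrite psi_small.
    apply: prefix_trans (prefix_take (psi s') k); rewrite psi_k // prefixE.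
    by rewrite take_takel ?(ltnW sk) // -prefixE.
  have ks' := leq_trans ks le; rewrite !psi_big //.
  have [m [c [pc rc fc]]] := hf s Ts ks; have [m' [c' [pc' rc' fc']]] := hf s' Ts' ks'.
  have kx : k <= size (map snd s) by rewrite size_map.
  have px : prefix (map snd s) (map snd s') by case/prefixP: ps => r ->; rewrite map_cat prefix_prefix.
  have [/andP[_ xp] lp _ _ _] := Pbuilt _ kx.
  have [||c2 [r2 p2 f2]] := @awake_above k T pT (f s') (P (map snd s)) c' (aliveA _ _ rc') _ _ rc'.
  - by rewrite lp m'; apply: Pabove.
  - exact: leq_trans xp.
  - rewrite lp size_map in f2.
    have ec : c2 = c by apply: (frontier_inj f2 fc (prefix_trans p2 pc') (prefix_trans pc ps)).
    subst c2; have e : take (size (P (map snd s))) (f s') = f s.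
      apply: (awake_uniq pT _ r2 rc); rewrite map_take m m'.
      by have [/prefixP[r ->] _] := Pabove _ _ kx px; rewrite take_size_cat.
    by rewrite -e prefix_take.
have pe : preembeds k T (alive k T) psi.
  split=> //.
  - move=> s Ts; split; first exact: psi_size.
    have [ks|sk] := leqP k (size s); last by rewrite psi_small // prefix_take.
    by rewrite -psi_k // prefix_take.
  - move=> s s' Ts Ts' e; have sz : size s = size s' by rewrite -[LHS](size_map snd) e size_map.
    have [ks|sk] := leqP k (size s); last by rewrite !psi_small // -sz.
    rewrite !psi_big -?sz //; have [-> _] := hf s Ts ks.
    by rewrite sz in ks; have [-> _] := hf s' Ts' ks; rewrite e.
have pA : pclosed (alive k T) by move=> s a; apply: alive_rcons.
have content z r n : br T z -> k <= r -> rank (pre z r) < n -> exists c,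
    [/\ run k T (psi (pre z n)) = Awake c, prefix c (pre z n) & r <= size c].
  move=> bz kr rn; have rn' : r < n by apply: leq_ltn_trans rn; rewrite -{1}(size_pre z r) size_rank.
  have kn : k <= size (pre z n) by rewrite size_pre; lia.
  have [_ [c [pc rc fc]]] := hf _ (bz n) kn; exists c; rewrite psi_big //; split=> //.
  have [_ _ h3] := fc; rewrite size_pre in h3; rewrite leqNgt; apply/negP => lt.
  have ec := prefix_preE pc; have := @rank_take (pre z r) (size c) r.
  rewrite size_pre lt leqnn take_pre ?(ltnW lt) // -ec take_oversize ?size_pre // => /(_ isT).
  by move: h3 rn; lia.
exists psi; split; first split=> //.
  move=> z z' bz bz' s e; have key r : k <= r -> pre z r = pre z' r.
    move=> kr; pose n := (maxn (rank (pre z r)) (rank (pre z' r))).+1.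
    have [|c [rc pc lc]] := content z r n bz kr; first by rewrite ltnS leq_maxl.
    have [|c' [rc' pc' lc']] := content z' r n bz' kr; first by rewrite ltnS leq_maxr.
    move: rc; rewrite (ext_psi_eq pe n bz bz' s e) rc' => -[ec]; subst c'.
    apply: (pre_le lc); rewrite -(take_pre z (n := n)); last by have := size_prefix pc; rewrite size_pre.
    rewrite -(take_pre z' (n := n)); last by have := size_prefix pc; rewrite size_pre.
    by move: pc pc'; rewrite !prefixE => /eqP-> /eqP->.
  apply: pre_inj => n; apply: (@pre_le _ _ n (maxn k n)); first exact: leq_maxr.
  exact/key/leq_maxl.
(* The question about [w] and [j] is settled while the level rises from [n] to [n.+1], so the first
   [n.+1] entries of the point decide. *)
move=> j z bz; pose w := pre z (k + j); pose n := rank w.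
have wn : k + j <= n by rewrite -{1}(size_pre z (k + j)) size_rank.
have szw : size w = k + j by rewrite size_pre.
exists n.+1 => z' bz' ez; pose x := map snd (pre z n).
have szx : size x = n by rewrite size_map size_pre.
have kx : k <= size x by rewrite szx; lia.
pose p' := P (rcons x (z n).2).
have ep : p' = P (map snd (pre z n.+1)) by rewrite preS map_rcons.
have [_ _ /(_ w j)] := hP x (z n).2 kx; rewrite szx => /(_ erefl szw (bz _)).
have fw : frontier k n w.
  split; rewrite ?szw ?leq_addr // => m /andP[km mw].
  by rewrite /n -{2}[w]take_size; apply: rank_take; rewrite szw mw leqnn.
have mw : map snd w = take (size w) x by rewrite szw /x -map_take take_pre.
move=> /(_ fw mw); rewrite -/p' => dec.
have cont y m : br T y -> pre y n.+1 = pre z n.+1 -> n < m -> exists c,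
    [/\ run k T (psi (pre y m)) = Awake c, prefix w c, prefix c (pre y m) &
      map snd (psi (pre y m)) = P (map snd (pre y m))].
  move=> by_ ey nm; have ew : pre y (k + j) = w by apply: (pre_le _ ey); lia.
  have [||c [rc pc lc]] := content y (k + j) m by_; first exact: leq_addr.
    by rewrite ew.
  exists c; split=> //.
    by rewrite (prefix_preE pc) -ew prefix_pre.
  have km : k <= size (pre y m) by rewrite size_pre; lia.
  by have [] := hf _ (by_ m) km; rewrite psi_big.
have eP y : pre y n.+1 = pre z n.+1 -> p' = P (map snd (pre y n.+1)) by move=> ->.
case: dec => dec.
  have yes y : br T y -> pre y n.+1 = pre z n.+1 -> fam j (ext psi y).
    move=> by_ ey; have [c [rc wc pc mc]] := cont y n.+1 by_ ey (ltnSn n).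
    apply: (dec (psi (pre y n.+1)) c) => //; first by rewrite mc -eP.
      exact: (ext_br pA pe by_).
    exact: (ext_pre_size pe n.+1 by_).
  by split=> _; apply: yes.
(* Membership in the open set would be forced by a longer thread still carrying an extension of [w],
   against the decision. *)
have no y : br T y -> pre y n.+1 = pre z n.+1 -> ~ fam j (ext psi y).
  move=> by_ ey fy; have bE := ext_br pA pe by_.
  have [M hM] := fam_open bE fy; pose m := maxn M n.+1.
  have nm : n < m by apply: leq_maxr.
  have [c [rc wc pc mc]] := cont y m by_ ey nm.
  apply: (dec (psi (pre y m)) c) => //.
    rewrite mc (eP y ey).
    have kx' : k <= size (map snd (pre y n.+1)) by rewrite size_map size_pre; lia.
    have := Pabove (map snd (pre y n.+1)) (map snd (pre y m)) kx'.
    rewrite size_map size_pre; apply.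
    by rewrite -(take_pre y nm) map_take prefix_take.
  move=> y' by' ey'; apply: hM => //; rewrite (ext_take pe M by_).
  have Mm : M <= size (psi (pre y m)).
    by apply: leq_trans (psi_size _ (by_ m)); rewrite size_pre leq_maxl.
  have /prefixP[r er] : prefix (psi (pre y m)) (psi (pre y (maxn m M))).
    by apply: psi_mono => //; apply: prefix_pre; apply: leq_maxl.
  rewrite -(take_pre y' Mm) ey' -(ext_pre pe by_ Mm) (ext_take pe M by_) //.
by split=> [/no|/no]; case.
Qed.

End Embed.

Lemma jump_exists k : exists H, oper k H /\
  forall T, pclosed T -> forall P : nat -> pts -> Prop,
  (forall j, relopen (H T) (P j)) ->
  exists psi, embeds k T (H T) psi /\ forall j, locconst T (P j \o ext psi).
Proof.
exists (alive k); split=> [|T pT P hP]; first exact: jump_oper.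
exact: jump_embed.
Qed.

(** * The key tree *)

Definition sect_isolated (T : tree) : Prop := forall z, br T z -> exists M,
  forall z', br T z' -> sect z z' -> pre z M = pre z' M -> z = z'.

Lemma fibred_isolated k T T' : fibred k T T' -> sect_isolated T' -> sect_isolated T.
Proof.
move=> [G [Phi [h1 h2 h3 h4 [h5 h6]]]] iT z bz.
have [Gz|nG] := pselect (G z); last exact: h2.
have [bP _] := h3 z bz Gz; have [m hm] := iT _ bP; have [M hM] := h5 z m bz Gz.
exists M => z' bz' s e; apply: pre_inj => r; apply: h6 => //.
by rewrite (hm (Phi z')) //; [have [] := h3 z' bz' (h1 _ _ bz bz' s Gz) | apply: h4 | apply: hM].
Qed.

(* A nonzero parameter must be the successor of the current key, and allows a new
   key to be chosen freely.  Hence the parameter reveals every key except, when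
   it is eventually zero, the last one. *)
Definition key_step (c : option nat) (a : sym) : option nat :=
  if c is Some c then
    if a.2 == 0 then (if a.1 == 0 then Some c else None)
    else (if a.2 == c.+1 then Some a.1 else None)
  else None.
Definition key (s : seq sym) : option nat := foldl key_step (Some 0) s.
Definition key_tree : tree := fun s => key s <> None.

Lemma key_rcons s a : key (rcons s a) = key_step (key s) a.
Proof. by rewrite /key foldl_rcons. Qed.

Lemma key_pclosed : pclosed key_tree.
Proof. by move=> s a; rewrite /key_tree key_rcons; case: (key s). Qed.

Lemma key_zero z t : br key_tree z -> (z t).2 = 0 ->
  (z t).1 = 0 /\ key (pre z t.+1) = key (pre z t).
Proof.
move=> /(_ t.+1); rewrite /key_tree preS key_rcons; case: (key _) => [c|] //= + e.
by rewrite e eqxx; case: eqP.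
Qed.

Lemma key_nonzero z t : br key_tree z -> (z t).2 <> 0 ->
  key (pre z t) = Some (z t).2.-1 /\ key (pre z t.+1) = Some (z t).1.
Proof.
move=> /(_ t.+1); rewrite /key_tree preS key_rcons; case: (key _) => [c|] //= + e.
by case: eqP => // _; case: eqP => // ->.
Qed.

(** If the parameter vanishes from [M] on, the first [M] entries fix the branch. Otherwise the
    section has one branch only, each key being the predecessor of the next nonzero parameter
    entry. *)
Lemma key_isolated : sect_isolated key_tree.
Proof.
move=> z bz.
have [[M hM]|/forallNP inf] := pselect (exists M, forall t, M <= t -> (z t).2 = 0).
  exists M => z' bz' s e; apply/funext => t.
  have [Mt|tM] := leqP M t; last by have /preP := e; apply.
  have z0 := hM t Mt; have z0' : (z' t).2 = 0 by rewrite -s.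
  have [y0 _] := key_zero bz z0; have [y0' _] := key_zero bz' z0'.
  by rewrite (surjective_pairing (z t)) (surjective_pairing (z' t)) y0 y0' z0 z0'.
exists 0 => z' bz' s _; apply/funext => t; rewrite (surjective_pairing (z t)).
rewrite (surjective_pairing (z' t)) -s; congr pair.
have [z0|nz] := eqVneq (z t).2 0.
  have z0' : (z' t).2 = 0 by rewrite -s.
  by have [-> _] := key_zero bz z0; have [-> _] := key_zero bz' z0'.
have /existsNP[t1 /not_implyP[lt1 nz1]] := inf t.+1.
have [t2 [[lt2 nz2] h2]] := @ex_least (fun t2 => t < t2 /\ (z t2).2 <> 0)
  (ex_intro _ t1 (conj lt1 nz1)).
have stay y : br key_tree y -> sect z y -> forall d, t.+1 + d <= t2 ->
    key (pre y (t.+1 + d)) = key (pre y t.+1).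
  move=> by_ sy; elim=> [|d IH] le; first by rewrite addn0.
  rewrite addnS (key_zero by_ _).2 ?IH //; first lia.
  rewrite -sy; apply: contrapT => nz3; have := h2 (t.+1 + d) (conj _ nz3); lia.
have last y : br key_tree y -> sect z y -> (y t).1 = (z t2).2.-1.
  move=> by_ sy; have := stay y by_ sy (t2 - t.+1); rewrite subnKC // => /(_ (leqnn _)).
  have nzt : (y t).2 <> 0 by rewrite -sy; apply/eqP.
  have nzt2 : (y t2).2 <> 0 by rewrite -sy.
  by rewrite (key_nonzero by_ nzt).2 (key_nonzero by_ nzt2).1 -sy => -[->].
by rewrite (last z) // (last z').
Qed.

Lemma key_infinite z N : br key_tree z -> exists w : nat -> pts,
  [/\ injective w, forall m, br key_tree (w m), forall m, pre (w m) N = pre z N &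
      forall m, sect (w 0) (w m)].
Proof.
move=> bz; case e : (key (pre z N)) => [c|]; last by case: (bz N).
(* The parameter [c.+1] at time [N] admits any new key [m], and the zeros after it never reveal
   which. *)
pose w m t := if t < N then z t else if t == N then (m, c.+1) else (0, 0).
have wN m : pre (w m) N = pre z N by apply/preP => t tN; rewrite /w tN.
exists w; split=> //.
- by move=> m m' /(congr1 (fun f => (f N).1)); rewrite /w ltnn eqxx.
- move=> m; have h d : key (pre (w m) (N + d).+1) = Some m.
    elim: d => [|d IH].
      by rewrite addn0 preS key_rcons wN e /w ltnn eqxx /= eqxx.
    rewrite addnS preS key_rcons IH /w.
    have -> : (N + d).+1 < N = false by lia.
    by have -> : ((N + d).+1 == N) = false by lia.
  move=> t; have [tN|Nt] := leqP t N.
    by rewrite -(take_pre _ tN) wN take_pre //; apply: bz.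
  by rewrite /key_tree -(ltn_predK Nt) -(subnKC (n := t.-1) (m := N)) ?h //; lia.
- by move=> m t; rewrite /w; case: ifP => // _; case: ifP.
Qed.

(** * Countable covers of the transformed key tree *)

Section Witness.
Variables (lt : nat -> nat -> Prop) (i : nat) (H : tree -> tree).
Hypotheses (oH : oper 0 H) (gH : opens 0 (sigma lt i) H).

(** The image of the zero branch lies in some [A n], whose preimage is relatively open in the key
    tree and so contains infinitely many branches of one section; the embedding is injective on that
    section. *)
Lemma no_finite_cover (A : nat -> pts -> Prop) : (forall n, sigma lt i (A n)) ->
  (forall z, br (H key_tree) z -> exists n, A n z) ->
  exists n (w : nat -> pts), [/\ injective w,
    forall m, br (H key_tree) (w m) /\ A n (w m) & forall m, sect (w 0) (w m)].
Proof.
move=> sA cA; have [psi [[pe inj] ro]] := gH key_pclosed sA.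
have [_ _ pH _] := oH; have pT := pH _ key_pclosed.
have bz : br key_tree (fun=> (0, 0)).
  move=> t; suff e : key (pre (fun=> (0, 0)) t) = Some 0 by rewrite /key_tree e.
  by elim: t => // t IH; rewrite preS key_rcons IH.
have [n An] := cA _ (ext_br pT pe bz); have [N hN] := ro n _ bz An.
have [w [wi wb wN ws]] := key_infinite N bz.
exists n, (fun m => ext psi (w m)); split=> [m m' e|m|m].
- apply: wi; apply: inj => // t; by rewrite -ws (ws m').
- by split; [apply: (ext_br pT pe (wb m)) | apply: (hN _ (wb m)); rewrite wN].
- exact: (ext_sect pe).
Qed.

End Witness.

(** * From trees to closed sets *)

(** Otherwise points outside [U] chosen in shrinking cylinders would converge to [f] coordinatewise,
    hence in the product. *)
Lemma prod_nbhs_cyl (K : topologicalType) (f : prod_topology (fun _ : nat => K))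
    (U : set (prod_topology (fun _ : nat => K))) :
  nbhs f U -> exists N, forall g : nat -> K, (forall i, i < N -> g i = f i) -> U g.
Proof.
move=> nU; apply: contrapT => /forallNP no.
have /choice[h hh] : forall N, exists g : nat -> K, (forall i, i < N -> g i = f i) /\ ~ U g.
  by move=> N; have /existsNP[g /not_implyP[h1 h2]] := no N; exists g.
pose h' : nat -> prod_topology (fun _ : nat => K) := h.
have hcvg : h' @ \oo --> f.
  apply/cvg_sup => N V [W] [[W' oW' <-] WfN WV].
  apply: (filterS WV); rewrite nbhs_simpl; exists N.+1 => // n /= Nn.
  by rewrite /h' /preimage /= (hh n).1.
have [N _ /(_ N (leqnn N))] := hcvg _ nU.
exact: (hh N).2.
Qed.

Lemma cyl_nbhs (K : discreteTopologicalType) (f : prod_topology (fun _ : nat => K)) N :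
  nbhs f [set g : prod_topology (fun _ : nat => K) | forall i, i < N -> g i = f i].
Proof.
elim: N => [|N IH]; first by apply: filterS filterT => g _ i.
have hN : nbhs f [set g : prod_topology (fun _ : nat => K) | g N = f N].
  have /= := @proj_continuous nat (fun=> K) N f [set f N]; apply.
  by apply: open_nbhs_nbhs; split=> //; apply: discrete_open.
apply: filterS (filterI IH hN) => g [h1 h2] i; rewrite ltnS leq_eqVlt.
by move=> /orP[/eqP->|/h1].
Qed.

Lemma cyl_open (K : discreteTopologicalType) (f : nat -> K) N :
  open ([set g | forall i, i < N -> g i = f i] : set (prod_topology (fun _ : nat => K))).
Proof.
rewrite openE => g gf; rewrite /interior; apply: filterS (cyl_nbhs g N) => h hg i iN.
by rewrite hg // gf.
Qed.

(* The parameter, a sequence of numbers, becomes a point of the Cantor space as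
   the characteristic function of its graph. *)
Definition graph (z : pts) : cantor_space :=
  fun m => let nv := odflt (0, 0) (unpickle m : option (nat * nat)) in
           (z nv.1).2 == nv.2.
(** Whole symbols are coded, parameter included, so that the point of the Baire space alone
    determines the branch. *)
Definition enc (z : pts) : baire_space := fun n => pickle (z n).
Definition dec (y : nat -> nat) : pts := fun n => odflt (0, 0) (unpickle (y n)).

Lemma encK z : dec (enc z) = z.
Proof. by apply/funext => n; rewrite /dec /enc pickleK. Qed.

Lemma graph_sect z z' : graph z = graph z' <-> sect z z'.
Proof.
split=> [e n|s]; last by apply/funext => m; rewrite /graph s.
have := congr1 (fun f : cantor_space => f (pickle (n, (z n).2))) e.
by rewrite /graph pickleK /= eqxx => /esym/eqP.
Qed.

Definition branches (T : tree) : set (cantor_space * baire_space) :=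
  [set p | exists z, [/\ br T z, graph z = p.1 & enc z = p.2]].

Lemma nbhs_cyl (p : cantor_space * baire_space) (U : set (cantor_space * baire_space)) :
  nbhs p U <-> exists N, forall x y, (forall i, i < N -> x i = p.1 i) ->
    (forall i, i < N -> y i = p.2 i) -> U (x, y).
Proof.
case: p => f g /=; split=> [[[V W] /= [nV nW] h]|[N hN]].
  have [N hV] := prod_nbhs_cyl nV; have [M hW] := prod_nbhs_cyl nW.
  exists (maxn N M) => x y hx hy; apply: h; split=> /=.
    by apply: hV => i iN; apply: hx; apply: leq_trans iN (leq_maxl _ _).
  by apply: hW => i iM; apply: hy; apply: leq_trans iM (leq_maxr _ _).
exists ([set x | forall i, i < N -> x i = f i], [set y | forall i, i < N -> y i = g i]).
  by split; [apply: (@cyl_nbhs bool) | apply: (@cyl_nbhs nat)].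
by move=> [x y] [/= hx hy]; apply: hN.
Qed.

(** A point is outside because some entry of [y] is not a code, or the decoded sequence leaves [T],
    or its graph differs from [x]; each is seen on finitely many coordinates. *)
Lemma branches_closed T : closed (branches T).
Proof.
rewrite -openC openE => -[x y] nF; apply/nbhs_cyl => /=.
pose z := dec y.
have [[n ny]|/forallNP hy] := pselect (exists n, pickle (z n) <> y n).
  exists n.+1 => x' y' _ ey [z' [_ _ /= e]]; apply: ny.
  by rewrite /z /dec -ey // -e /enc pickleK.
have ey : enc z = y by apply/funext => n; apply: contrapT; apply: hy.
have prez (y' : nat -> nat) n : (forall i, i < n -> y' i = y i) -> pre (dec y') n = pre z n.
  by move=> h; apply/preP => m mn; rewrite /z /dec h.
have [[n nT]|/forallNP hT] := pselect (exists n, ~ T (pre z n)).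
  exists n => x' y' _ h [z' [bz' _ /= e]]; apply: nT.
  by rewrite -(prez y' n h) -e encK; apply: bz'.
have bz : br T z by move=> n; apply: contrapT; apply: hT.
have [m nm] : exists m, graph z m <> x m.
  apply/existsNP => e; apply: nF; exists z; split=> //.
  exact/funext.
pose n := (odflt (0, 0) (unpickle m : option (nat * nat))).1.
exists (maxn m n).+1 => x' y' hx hy' [z' [_ /= e1 e2]]; apply: nm.
rewrite -hx ?ltnS ?leq_maxl // -e1 /graph -/n.
have /preP := prez y' (maxn m n).+1 hy'; rewrite -e2 encK => /(_ n) <- //.
by rewrite ltnS leq_maxr.
Qed.

Lemma sigma_of_Sigma0 (lt : nat -> nat -> Prop) i (S : set (cantor_space * baire_space)) :
  Sigma0 lt i S -> sigma lt i (fun z => S (graph z, enc z)).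
Proof.
elim=> {i S} [i S oS|i A j lj _ IH].
  apply: sigma_open => z Sz.
  have /nbhs_cyl[N hN] : nbhs (graph z, enc z) S by apply: open_nbhs_nbhs.
  (* [b] bounds the entries of [z] on which the first [N] bits of its graph depend. *)
  pose b := \max_(m < N) (odflt (0, 0) (unpickle m : option (nat * nat))).1.+1.
  exists (maxn N b) => z' e; have /preP e' := e; apply: hN => m mN /=.
    rewrite /graph e' // leq_max; apply/orP; right.
    exact: (@leq_bigmax _ (fun m : 'I_N => (odflt (0, 0) (unpickle m : option (nat * nat))).1.+1) (Ordinal mN)).
  by rewrite /enc e' // leq_max mN.
rewrite (_ : (fun z => _) = fun z => exists n, A n (graph z, enc z)).
  exact: (@sigma_union lt i (fun n z => A n (graph z, enc z)) j lj IH).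
apply/funext => z; apply/propext; split=> [[n _ h]|[n h]]; first by exists n.
by exists n.
Qed.

(** * Sections of the closed set *)

Section Sections.
Variables (T : tree) (x : cantor_space).
Hypothesis iT : sect_isolated T.

Lemma section_isolated (y : baire_space) : exists M, section (branches T) x y ->
  forall y', section (branches T) x y' -> mkseq y M = mkseq y' M -> y = y'.
Proof.
have [[z [bz /= e1 e2]]|n] := pselect (section (branches T) x y); last by exists 0 => /n.
have [M hM] := iT bz; exists M => _ y' [z' [bz' /= e1' e2']] e.
rewrite -e2 -e2' (hM z') //; first by apply/graph_sect; rewrite e1 e1'.
have decE u : pre (dec u) M = [seq odflt (0, 0) (unpickle i) | i <- mkseq u M].
  by rewrite /pre /mkseq -map_comp.
by rewrite -(encK z) -(encK z') !decE e2 e2' e.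
Qed.

Lemma section_countable : countable (section (branches T) x).
Proof.
have /choice[M hM] := section_isolated; apply/countable_injP.
(* Each point is coded by its isolating prefix; equal prefixes have equal lengths, so the isolation
   applies. *)
exists (fun y => pickle (mkseq y (M y))) => y y'; rewrite !inE => Fy Fy'.
move=> /(pcan_inj pickleK) e; apply: (hM y Fy) => //.
by have := congr1 size e; rewrite !size_mkseq => eM; rewrite e eM.
Qed.

Lemma section_discrete : discrete_set (section (branches T) x).
Proof.
move=> y Fy; have [M hM] := section_isolated y.
exists [set g | forall i, i < M -> g i = y i]; split=> //.
  exact: (@cyl_open nat).
apply/seteqP; split=> [g [/= h Fg]|g ->] //; apply/esym; apply: hM => //.
by apply/eq_in_map => i; rewrite mem_iota => /andP[_ iM]; rewrite h.
Qed.

(** Isolating cylinders cover [K], and each contains a single point of [K]; a finite subcover leaves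
    no room for infinitely many [w m]. *)
Lemma section_compact_finite (K : set baire_space) (w : nat -> baire_space) :
  compact K -> K `<=` section (branches T) x -> (forall m, K (w m)) -> ~ injective w.
Proof.
move=> cK KF wK wi; have /choice[M hM] := section_isolated.
pose U (s : seq nat) : set baire_space := [set g | forall i, i < size s -> g i = nth 0 s i].
pose D : set (seq nat) := [set s | exists2 y, K y & s = mkseq y (M y)].
rewrite compact_cover in cK; have [||D' sD cov] := cK _ D U.
- by move=> s _; apply: (@cyl_open nat).
- move=> y Ky; exists (mkseq y (M y)); first by exists y.
  by move=> i; rewrite size_mkseq => iM; rewrite nth_mkseq.
have /choice[s hs] : forall m, exists s, s \in finmap.enum_fset D' /\ U s (w m).
  by move=> m; have [s sD' Us] := cov _ (wK m); exists s.
have si : injective s.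
  move=> m m' e; apply: wi; have [/sD + Um] := hs m; rewrite inE => -[y Ky ey].
  have [_ Um'] := hs m'; rewrite -e in Um'.
  have ew v : K v -> U (s m) v -> y = v.
    move=> Kv Uv; apply: (hM y) => //; try exact: KF.
    rewrite -ey; apply: (@eq_from_nth _ 0); first by rewrite ey !size_mkseq.
    by move=> i il; rewrite -Uv // nth_mkseq //; move: il; rewrite ey size_mkseq.
  by rewrite -(ew (w m)) // -(ew (w m')).
have := @uniq_leq_size _ [seq s m | m <- iota 0 (size (finmap.enum_fset D')).+1] (finmap.enum_fset D').
rewrite map_inj_uniq // iota_uniq size_map size_iota => /(_ isT).
suff h : {subset [seq s m | m <- iota 0 (size (finmap.enum_fset D')).+1] <= finmap.enum_fset D'} by move=> /(_ h); rewrite ltnn.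
by move=> _ /mapP[m _ ->]; have [] := hs m.
Qed.

End Sections.

Theorem theorem1p3 (lt : nat -> nat -> Prop) (i : nat) :
  strict_wellorder lt ->
  exists F : set (cantor_space * baire_space),
    [/\ closed F,
        (forall x : cantor_space,
            countable (section F x) /\ discrete_set (section F x))
      & ~ (exists B : nat -> set (cantor_space * baire_space),
             [/\ (forall n, B n `<=` F),
                 F `<=` \bigcup_n B n,
                 (forall n, Sigma0 lt i (B n))
               & (forall n (x : cantor_space), compact (section (B n) x))])].
Proof.
move=> [wf _ _]; have [H [oH gH]] := hierarchy_opens jump_exists wf i 0.
have iT : sect_isolated (H key_tree).
  have [_ _ _ fH] := oH; apply: fibred_isolated key_isolated.
  exact: fH key_pclosed.
exists (branches (H key_tree)); split.
- exact: branches_closed.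
- by move=> x; split; [apply: section_countable | apply: section_discrete].
move=> [B [BF cov sB cB]].
have [|z bz|n [w [wi wB ws]]] := @no_finite_cover lt i H oH gH
    (fun n z => B n (graph z, enc z)).
- by move=> n; apply: sigma_of_Sigma0.
- by have [|n _ Bn] := cov (graph z, enc z); [exists z | exists n].
(* The points [enc (w m)] are infinitely many members of the section of [B n] at [graph (w 0)],
   against its compactness. *)
apply: (@section_compact_finite _ (graph (w 0)) iT _ (fun m => enc (w m)) (cB n _)).
- by move=> y; apply: BF.
- move=> m; have [_] := wB m; rewrite /section /=.
  by have /graph_sect <- := ws m.
- by move=> m m' e; apply: wi; rewrite -(encK (w m)) e encK.
Qed.
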